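(* Let $Z\sim N_d(\theta,\sigma^2 I_d)$ with $\theta\in\mathbb{R}^d$ unknown and $\sigma^2>0$ known, and let $p>0$. Assume $d\ge 3$ and $0\le\alpha<(d-2)/(d-1)$, and put $$\gamma(d,p,\alpha)=\min\bigl(1,d^{(2-p-\alpha)/p}\bigr)\left\{1-\alpha\frac{d-1}{d-2}\right\}.$$ Assume $\phi(v)$ is absolutely continuous and $0\le\phi(v)\le 2(d-2)\gamma(d,p,\alpha)$. Assume further that, over all $v$ with $\phi(v)<2(d-2)\gamma(d,p,\alpha)$, $$g_\phi(v)=\frac{v^{d-2-\alpha(d-1)}\phi(v)}{2(d-2)\gamma(d,p,\alpha)-\phi(v)}$$ is non-decreasing, and that if there exists $v_*>0$ such that $\phi(v_* )=2(d-2)\gamma(d,p,\alpha)$, then $\phi(v)=2(d-2)\gamma(d,p,\alpha)$ for all $v\ge v_*$. Then the estimator $\hat\theta_\phi$ with $i$-th component ($i=1,\dots,d$) $$\hat\theta_{i\phi}=\left(1-\frac{\sigma^2\phi(\|z\|_p/\sigma)}{\|z\|_p^{2-\alpha}|z_i|^{\alpha}}\right)z_i$$ is minimax.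
   Context: For $p>0$, $\|z\|_p=\{\sum_{i=1}^d|z_i|^p\}^{1/p}$. The function $\phi$ is a real-valued function of $v\ge 0$. The loss of an estimator $\delta$ is $L(\delta,\theta)=\sum_{i=1}^d(\delta_i-\theta_i)^2/\sigma^2$ and its risk is $E[L(\delta(Z),\theta)]$. An estimator is minimax if it minimizes $\sup_\theta E[L(\delta(Z),\theta)]$ among all estimators. The estimator $z$ is minimax with constant risk $d$, so $\delta$ is minimax if and only if its risk is at most $d$ for every $\theta$. The estimator is defined for $z$ with all coordinates nonzero, which holds almost surely. *)

(* Defs.v *)
From mathcomp Require Import all_boot all_order all_algebra.
From mathcomp Require Import all_classical all_reals all_analysis.
From HB Require Import structures.

Set Implicit Arguments.
Unset Strict Implicit.
Unset Printing Implicit Defensive.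

Import Order.TTheory GRing.Theory Num.Theory.
Import numFieldNormedType.Exports.

Local Open Scope classical_set_scope.
Local Open Scope ring_scope.

Notation vec R n := (n.-tuple (measurableTypeR R)).

Definition vcons (R : realType) n (x : measurableTypeR R * vec R n) :
  vec R n.+1 := [tuple of x.1 :: x.2].

Lemma measurable_vcons (R : realType) n : measurable_fun setT (@vcons R n).
Proof. by apply: measurable_cons => //; exact: measurable_fst. Qed.

HB.instance Definition _ (R : realType) n :=
  isMeasurableFun.Build _ _ _ _ (@vcons R n) (@measurable_vcons R n).

(* N_n(theta, s^2 I_n), the product of the measures N(theta_i, s^2) (see
   normal_vecX). As in normal_prob, s is the standard deviation. *)
Fixpoint normal_vec (R : realType) n (s : R) :
    vec R n -> probability (vec R n) R :=
  match n with
  | 0%N => fun=> dirac [tuple]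
  | m.+1 => fun theta =>
      distribution (normal_prob (thead theta) s \x
                    normal_vec s [tuple of behead theta])%E (@vcons R m)
  end.

Lemma normal_vecX (R : realType) n (s : R) (theta : vec R n)
    (A : 'I_n -> set (measurableTypeR R)) :
  (forall i, measurable (A i)) ->
  normal_vec s theta [set z | forall i, A i (tnth z i)] =
  (\prod_(i < n) normal_prob (tnth theta i) s (A i))%E.
Proof.
elim: n theta A => [|n IHn] theta A mA.
  by rewrite big_ord0 /= diracE mem_set //= => -[].
rewrite big_ord_recl /= /distribution /pushforward /=.
pose B := [set z : vec R n | forall i, A (lift ord0 i) (tnth z i)].
have mB : measurable B.
  rewrite (_ : B = \bigcap_(i in [set: 'I_n])
      ((fun z : vec R n => tnth z i) @^-1` A (lift ord0 i))).
    apply: fin_bigcap_measurable => // i _.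
    by rewrite -[X in measurable X]setTI; exact: measurable_tnth.
  by apply/seteqP; split => z Bz i => [_|]; exact: Bz.
rewrite (_ : _ @^-1` _ = A ord0 `*` B); last first.
  apply/seteqP; split => -[x z] /=.
    move=> Az; split; first by have := Az ord0.
    by move=> i; have := Az (lift ord0 i); rewrite tnthS.
  by move=> [Ax Bz] i; case: (unliftP ord0 i) => [j|] -> //; rewrite tnthS.
rewrite product_measure1E //; congr (_ * _)%E.
transitivity (\prod_(i < n) normal_prob (tnth [tuple of behead theta] i) s
    (A (lift ord0 i)))%E; first by apply: IHn => i; exact: mA.
by apply: eq_bigr => i _; rewrite [theta in RHS]tuple_eta tnthS.
Qed.

Definition norm_p (R : realType) n (p : R) (z : vec R n) : R :=
  (\sum_(i < n) `|tnth z i| `^ p) `^ p^-1.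

Definition loss (R : realType) n (s : R) (a theta : vec R n) : R :=
  \sum_(i < n) (tnth a i - tnth theta i) ^+ 2 / s ^+ 2.

(* A statistical model is a family P of probabilities on Omega, indexed by the
   parameter, together with an observation Z. *)
Definition risk (R : realType) n (s : R) disp (Omega : measurableType disp)
    (P : vec R n -> probability Omega R) (Z : Omega -> vec R n)
    (delta : vec R n -> vec R n) (theta : vec R n) : \bar R :=
  ('E_(P theta)[fun w => loss s (delta (Z w)) theta])%E.

Definition minimax (R : realType) n (s : R) disp (Omega : measurableType disp)
    (P : vec R n -> probability Omega R) (Z : Omega -> vec R n)
    (delta : vec R n -> vec R n) : Prop :=
  measurable_fun setT delta /\
  forall delta' : vec R n -> vec R n, measurable_fun setT delta' ->
    (ereal_sup (range (risk s P Z delta)) <=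
     ereal_sup (range (risk s P Z delta')))%E.

Definition abs_continuous_itv (R : realType) (a b : R) (f : R -> R) : Prop :=
  forall e : R, 0 < e -> exists2 r : R, 0 < r &
    forall n (u v : 'I_n -> R),
      (forall i, [/\ a <= u i, u i <= v i & v i <= b]) ->
      (forall i j, i != j -> v i <= u j \/ v j <= u i) ->
      \sum_(i < n) (v i - u i) < r ->
      \sum_(i < n) `|f (v i) - f (u i)| < e.

(* Absolute continuity on the unbounded interval [0, +oo[ is meant on each of
   its compact subintervals, as is usual; a single r for all of [0, +oo[ is not
   required. *)
Definition abs_continuous_nonneg (R : realType) (f : R -> R) : Prop :=
  forall a b : R, 0 <= a -> a <= b -> abs_continuous_itv a b f.

Definition gamma (R : realType) (d : nat) (p alpha : R) : R :=
  Num.min 1 (d%:R `^ ((2 - p - alpha) / p)) *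
  (1 - alpha * ((d%:R - 1) / (d%:R - 2))).

Definition gphi (R : realType) (d : nat) (p alpha : R) (phi : R -> R) (v : R) :=
  v `^ (d%:R - 2 - alpha * (d%:R - 1)) * phi v /
  (2 * (d%:R - 2) * gamma d p alpha - phi v).

(* When some coordinate of z is 0, an event of probability 0, the value is
   the one given by the conventions of the library, including x / 0 = 0. *)
Definition theta_hat (R : realType) d (s p alpha : R) (phi : R -> R)
    (z : vec R d) : vec R d :=
  [tuple (1 - s ^+ 2 * phi (norm_p p z / s) /
              (norm_p p z `^ (2 - alpha) * `|tnth z i| `^ alpha)) * tnth z i
  | i < d].

(* Main.v *)
Require Import Defs.
From mathcomp Require Import all_boot all_order all_algebra.
From mathcomp Require Import all_classical all_reals all_analysis.
From mathcomp Require Import measurable_realfun.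
From HB Require Import structures.
From mathcomp Require Import ring lra.

Set Implicit Arguments.
Unset Strict Implicit.
Unset Printing Implicit Defensive.

Import Order.TTheory GRing.Theory Num.Theory.
Import numFieldNormedType.Exports.

Local Open Scope classical_set_scope.
Local Open Scope ring_scope.

(** The estimator z has constant risk d, so minimaxity amounts to two bounds:
   every estimator has worst-case risk at least d, and the shrinkage estimator
   has risk at most d at every theta.

   Lower bound ([sup_risk_ge]). The worst-case risk dominates the average risk
   under the prior N(0, tau^2 I). With the observation written as mean plus
   noise, prior and noise are independent; resampling the i-th coordinate of
   both with the others frozen leaves a one-dimensional Bayes problem, whose
   optimal value is the posterior variance s^2 tau^2 / (s^2 + tau^2)
   ([normal_bayes_risk]). Summing over i and letting tau grow gives d.

   Upper bound ([risk_le]). The estimator is z - s^2 g with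
   g_i = psi(r) r^(a-2) |z_i|^(-a) z_i, where r is the p-norm of z and
   psi(r) = phi(r / s). Expanding the square, its risk is
   d + E[s^2 sum g_i^2 - 2 sum (z_i - theta_i) g_i]. Stein's identity would
   replace the last sum by s^2 times the divergence of g, which contains the
   derivative of psi. A lower bound for the divergence is enough. Put
   k = d - 2 - a (d - 1). As v^k psi(v) / (c - psi(v)) is non-decreasing, psi
   lies to the right of each v0 above the curve c K / (v^k + K) through
   (v0, psi(v0)), whose slope at v0 is - k psi (c - psi) / (c v0). Hence g_i, as
   a function of z_i > 0, lies to the right of each point above a smooth
   function whose derivative there is explicit ([correction_slope], [drift]). A
   fundamental theorem of calculus for functions with such minorants
   ([integral_le0_of_minorants]) turns this into one half of Stein's identity
   on every coordinate line ([normal_stein_le]), and Fubini's theorem, in the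
   form that resampling one coordinate preserves the law
   ([resample_normal_vec]), assembles the lines.

   There remains the pointwise inequality sum g_i^2 <= 2 sum drift_i
   ([drift_ge]). It rests on two comparisons of the power sums
   S(q) = sum |z_i|^q. Chebyshev's sum inequality gives
   d S(p - a) / S(p) <= S(-a), and the definition of gamma is made for
   d min(1, d^((2-p-a)/p)) r^(a-2) S(2 - 2a) <= S(-a).

   All the integrals converge because d >= 3: g_i^2 and drift_i are bounded by
   functions homogeneous of degree - 2, and these by a product of negative
   powers of three distinct coordinates, each with exponent less than 1
   ([integrable_powRN_coordinates]). *)

(** * Gaussian vectors and resampling a coordinate *)

Section vectors.
Context {R : realType}.
Implicit Types (n : nat) (s : R).

Definition box n (A : 'I_n -> set (measurableTypeR R)) : set (vec R n) :=
  [set z | forall i, A i (tnth z i)].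

Lemma measurable_box n (A : 'I_n -> set (measurableTypeR R)) :
  (forall i, measurable (A i)) -> measurable (box A).
Proof.
move=> mA; rewrite (_ : box A = \bigcap_(i in [set: 'I_n])
    ((fun z : vec R n => tnth z i) @^-1` A i)).
  apply: fin_bigcap_measurable => // i _.
  by rewrite -[X in measurable X]setTI; exact: measurable_tnth.
by apply/seteqP; split => z Bz i => [_|]; exact: Bz.
Qed.

(** Boxes are stable under intersection and generate the product
   sigma-algebra. *)
Lemma box_measure_unique n (mu nu : probability (vec R n) R) :
  (forall A : 'I_n -> set (measurableTypeR R), (forall i, measurable (A i)) ->
     mu (box A) = nu (box A)) ->
  forall B, measurable B -> mu B = nu B.
Proof.
move=> munu B mB.
pose G := [set B : set (vec R n) | exists2 A : 'I_n -> set (measurableTypeR R),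
  (forall i, measurable (A i)) & B = box A].
have GT : G setT by exists (fun=> setT) => //; apply/seteqP; split.
apply: (@measure_unique _ _ _ G (fun=> setT)) => //.
- apply/seteqP; split.
    apply: smallest_sub; first exact: smallest_sigma_algebra.
    rewrite -bigcup_seq => A [i _] [D mD <-]; rewrite setTI.
    apply: sub_sigma_algebra; exists (fun j => if j == i then D else setT).
      by move=> j; case: ifP.
    apply/seteqP; split => z /=; first by move=> Dz j; case: ifPn => // /eqP ->.
    by move=> /(_ i); rewrite eqxx.
  apply: smallest_sub; first exact: sigma_algebra_measurable.
  by move=> _ [A mA ->]; exact: measurable_box.
- move=> _ _ [A mA ->] [D mD ->]; exists (fun i => A i `&` D i).
    by move=> i; exact: measurableI.
  apply/seteqP; split => z /=; first by move=> [Az Dz] i; split;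
    [exact: Az|exact: Dz].
  by move=> ADz; split=> i; have [] := ADz i.
- by rewrite bigcup_const.
- by move=> _ [A mA ->]; exact: munu.
- by move=> k; rewrite /= probability_setT ltry.
Qed.

Definition upd n (z : vec R n) (i : 'I_n) (x : R) : vec R n :=
  [tuple if j == i then x else tnth z j | j < n].

Definition upd_pair n (i : 'I_n) (zx : vec R n * measurableTypeR R) : vec R n :=
  upd zx.1 i zx.2.

Lemma measurable_upd n (i : 'I_n) : measurable_fun setT (upd_pair i).
Proof.
apply/measurable_fun_tnthP => j.
rewrite (_ : _ \o _ = fun zx : vec R n * measurableTypeR R =>
  if j == i then zx.2 else tnth zx.1 j); last first.
  by apply/funext => zx /=; rewrite tnth_mktuple.
case: eqP => _; first exact: measurable_snd.
by apply: (measurableT_comp (measurable_tnth j)) => //; exact: measurable_fst.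
Qed.

HB.instance Definition _ n (i : 'I_n) :=
  isMeasurableFun.Build _ _ _ _ _ (measurable_upd i).

Lemma normal_vec_box n s (theta : vec R n) A : (forall i, measurable (A i)) ->
  normal_vec s theta (box A) = (\prod_(i < n) normal_prob (tnth theta i) s (A
    i))%E.
Proof. exact: normal_vecX. Qed.

(** The coordinates are independent, so replacing one of them by a fresh copy
   does not change the law. This is the form in which Fubini's theorem is used:
   it allows integrating along one coordinate with the others frozen. *)
Lemma resample_normal_vec n s (theta : vec R n) (i : 'I_n) B : measurable B ->
  normal_vec s theta B = distribution
    (normal_vec s theta \x normal_prob (tnth theta i) s)%E
    (upd_pair i) B.
Proof.
move=> mB; apply: box_measure_unique => // A mA.
rewrite normal_vec_box// /distribution /pushforward /=.
pose A' j := if j == i then setT else A j.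
have mA' j : measurable (A' j) by rewrite /A'; case: ifP.
rewrite (_ : _ @^-1` _ = box A' `*` A i); last first.
  apply/seteqP; split => -[z x] /=.
    move=> Az; split; last by have := Az i; rewrite tnth_mktuple eqxx.
    by move=> j; rewrite /A'; case: ifPn => // /negbTE ji; have := Az j;
      rewrite tnth_mktuple ji.
  move=> [Az Ax] j; rewrite tnth_mktuple; case: ifPn => [/eqP ->//|ji].
  by have := Az j; rewrite /A' (negbTE ji).
rewrite product_measure1E//; last exact: measurable_box.
rewrite [X in _ = (X * _)%E](normal_vec_box s theta mA') [LHS](bigD1 i)//=
  muleC; congr (_ * _)%E.
rewrite [RHS](bigD1 i)//= {1}/A' eqxx probability_setT mul1e.
by apply: eq_bigr => j /negbTE ji; rewrite /A' ji.
Qed.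

Lemma ge0_integral_resample n s (theta : vec R n) (i : 'I_n)
    (f : vec R n -> \bar R) :
  measurable_fun [set: vec R n] f -> (forall z, 0 <= f z)%E ->
  (\int[normal_vec s theta]_z f z =
   \int[normal_vec s theta]_z
     \int[normal_prob (tnth theta i) s]_x f (upd z i x))%E.
Proof.
move=> mf f0.
rewrite (eq_measure_integral _ (fun B mB _ => resample_normal_vec s theta i
  mB)).
rewrite ge0_integral_distribution//.
rewrite fubini_tonelli1//.
  by apply: measurableT_comp => //; exact: measurable_upd.
by move=> zx /=.
Qed.

Lemma integrable_upd_pair n s (theta : vec R n) (i : 'I_n)
    (f : vec R n -> \bar R) :
  (normal_vec s theta).-integrable setT f ->
  (normal_vec s theta \x normal_prob (tnth theta i) s)%E.-integrable setT
    (f \o upd_pair i).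
Proof.
move=> intf; have mf := measurable_int _ intf.
have mfu : measurable_fun setT (f \o upd_pair i).
  by apply: measurableT_comp => //; exact: measurable_upd.
apply/integrableP; split=> //; move/integrableP : intf => [_].
rewrite (eq_measure_integral _ (fun B mB _ => resample_normal_vec s theta i
  mB)).
by rewrite ge0_integral_distribution//; exact: measurableT_comp.
Qed.

Lemma integrable_resample n s (theta : vec R n) (i : 'I_n)
    (f : vec R n -> \bar R) :
  (normal_vec s theta).-integrable setT f ->
  (normal_vec s theta).-integrable setT
    (fun z => \int[normal_prob (tnth theta i) s]_x f (upd z i x))%E.
Proof.
move=> intf; exact: (integrable_fubini_F (integrable_upd_pair i intf)).
Qed.

Lemma integral_resample n s (theta : vec R n) (i : 'I_n)
    (f : vec R n -> \bar R) :
  (normal_vec s theta).-integrable setT f ->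
  (\int[normal_vec s theta]_z f z =
   \int[normal_vec s theta]_z
     \int[normal_prob (tnth theta i) s]_x f (upd z i x))%E.
Proof.
move=> intf; have mf := measurable_int _ intf.
rewrite (eq_measure_integral _ (fun B mB _ => resample_normal_vec s theta i
  mB)).
rewrite integral_distribution//; last exact: integrable_upd_pair.
by rewrite -integral12_prod_meas1//; exact: integrable_upd_pair.
Qed.

End vectors.

(** * The normal law on the line *)

Section normal_line.
Context {R : realType}.
Notation mu := (@lebesgue_measure R).

(** The Radon-Nikodym derivative of the law agrees almost everywhere with the
   density, by uniqueness of that derivative. *)
Lemma ge0_integral_normal_prob (m s : R) (f : R -> \bar R) D :
  measurable D ->
  measurable_fun D f -> (forall x, 0 <= f x)%E ->
  (\int[normal_prob m s]_(x in D) f x =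
   \int[mu]_(x in D) (f x * (normal_pdf m s x)%:E))%E.
Proof.
move=> mD mf f0.
have dom := normal_prob_dominates m s.
rewrite -(Radon_Nikodym_SigmaFinite.change_of_variables dom)//.
have mpdf : measurable_fun D (fun x => (normal_pdf m s x)%:E).
  by apply/measurable_EFinP/measurable_funTS; exact: measurable_normal_pdf.
have mrn : measurable_fun D (Radon_Nikodym_SigmaFinite.f (normal_prob m s) mu).
  apply: measurable_funTS; apply: (measurable_int mu).
  exact: Radon_Nikodym_SigmaFinite.f_integrable.
apply: ae_eq_integral => //; [exact: emeasurable_funM|exact: emeasurable_funM|].
apply: ae_eqe_mul2l; apply: integral_ae_eq => //.
  apply: (integrableS measurableT) => //.
  exact: Radon_Nikodym_SigmaFinite.f_integrable.
by move=> E ED mE; rewrite -Radon_Nikodym_SigmaFinite.f_integral.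
Qed.

Lemma integral_normal_prob (m s : R) (f : R ->
  R) (D : set (measurableTypeR R)) :
  measurable D -> measurable_fun D f ->
  (\int[normal_prob m s]_(x in D) (f x)%:E =
   \int[mu]_(x in D) (f x * normal_pdf m s x)%:E)%E.
Proof.
move=> mD mf.
have mfE : measurable_fun D (EFin \o f) by exact/measurable_EFinP.
rewrite integralE [RHS]integralE; congr (_ - _)%E.
  rewrite ge0_integral_normal_prob; [|exact: mD|exact:
    measurable_funepos|exact: funepos_ge0].
  apply: eq_integral => x _; rewrite !funeposE -!EFin_max -EFinM.
  by rewrite maxr_pMl ?normal_pdf_ge0// mul0r.
rewrite ge0_integral_normal_prob; [|exact: mD|exact: measurable_funeneg|exact:
  funeneg_ge0].
apply: eq_integral => x _; rewrite !funenegE -!EFinN -!EFin_max -EFinM.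
by rewrite maxr_pMl ?normal_pdf_ge0// mul0r mulNr.
Qed.

Lemma integrable_normal_prob (m s : R) (f : R ->
  R) (D : set (measurableTypeR R)) :
  measurable D -> (normal_prob m s).-integrable D (EFin \o f) ->
  mu.-integrable D (fun x => (f x * normal_pdf m s x)%:E).
Proof.
move=> mD intf; have mf : measurable_fun D f.
  by have /measurable_EFinP := measurable_int _ intf.
apply/integrableP; split.
  by apply/measurable_EFinP/measurable_funM => //; apply: measurable_funTS;
    exact: measurable_normal_pdf.
move/integrableP : intf => [_]; rewrite ge0_integral_normal_prob;
  [|exact: mD| |by move=> x; exact: abse_ge0].
  congr (_ < _)%E; apply: eq_integral => x _.
  by rewrite /= normrM (ger0_norm (normal_pdf_ge0 _ _ _)) EFinM.
by apply/measurable_EFinP; apply: measurableT_comp.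
Qed.

Definition translate (c : R) (x : measurableTypeR R) : measurableTypeR R :=
  x + c.

Lemma measurable_translate c : measurable_fun setT (translate c).
Proof. exact: measurable_funD. Qed.

HB.instance Definition _ c :=
  isMeasurableFun.Build _ _ _ _ (translate c) (measurable_translate c).

Lemma lebesgue_measure_translate (c : R) (A : set R) : measurable A ->
  pushforward mu (translate c) A = mu A.
Proof.
move=> mA; apply/esym/lebesgue_measure_unique => //= _ [[a b]] _ <-.
rewrite /pushforward (_ : _ @^-1` _ = `]a - c, b - c]%classic); last first.
  by apply/seteqP; split => x /=; rewrite !in_itv/= ltrBlDr lerBrDr.
rewrite !lebesgue_measure_itv/= !lte_fin ltrD2r.
by rewrite -!EFinB opprB addrA subrK.
Qed.

Lemma normal_pdf_translate (m c s x : R) : s != 0 ->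
  normal_pdf (m + c) s (x + c) = normal_pdf m s x.
Proof.
by move=> s0; rewrite !normal_pdfE// /normal_fun opprD addrACA subrr addr0.
Qed.

Lemma normal_pdfN (m s x : R) : s != 0 -> normal_pdf (- m) s (- x) = normal_pdf
  m s x.
Proof. by move=> s0; rewrite !normal_pdfE// /normal_fun -opprD sqrrN. Qed.

Lemma normal_prob_translate (m c s : R) (A : set R) : s != 0 -> measurable A ->
  normal_prob (m + c) s A = pushforward (normal_prob m s) (translate c) A.
Proof.
move=> s0 mA; rewrite /normal_prob.
rewrite (eq_measure_integral (pushforward mu (translate c))); last first.
  by move=> B mB _; apply/esym/lebesgue_measure_translate.
rewrite ge0_integral_pushforward; first last.
- by move=> x _; rewrite lee_fin normal_pdf_ge0.
- by apply/measurable_EFinP/measurable_funTS; exact: measurable_normal_pdf.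
- exact: mA.
- exact: measurable_translate.
by rewrite /pushforward; apply: eq_integral => x _; congr _%:E;
  exact: normal_pdf_translate.
Qed.

Definition opp_line (x : measurableTypeR R) : measurableTypeR R := - x.

Lemma measurable_opp_line : measurable_fun setT opp_line.
Proof. exact: oppr_measurable. Qed.

HB.instance Definition _ :=
  isMeasurableFun.Build _ _ _ _ opp_line measurable_opp_line.

Lemma normal_probN (m s : R) (A : set R) : s != 0 -> measurable A ->
  normal_prob (- m) s A = pushforward (normal_prob m s) opp_line A.
Proof.
move=> s0 mA; rewrite /normal_prob.
rewrite (eq_measure_integral (pushforward mu opp_line)); last first.
  by move=> B mB _; apply/esym/lebesgue_measureN.
rewrite ge0_integral_pushforward; first last.
- by move=> x _; rewrite lee_fin normal_pdf_ge0.
- by apply/measurable_EFinP/measurable_funTS; exact: measurable_normal_pdf.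
- exact: mA.
- exact: measurable_opp_line.
by rewrite /pushforward; apply: eq_integral => x _; congr _%:E;
  exact: normal_pdfN.
Qed.

End normal_line.

(** * A fundamental theorem of calculus from local minorants *)

Section lower_slope.
Context {R : realType}.

(** For e > 0, the set of the x with U a <= U x + e * (x - a) contains its
   supremum by continuity. If that supremum were less than b, the minorant
   there, having derivative 0, would lose less than e per unit length and put
   further points into the set. *)
Lemma le_of_minorants (U : R -> R) (a b : R) : a <= b ->
  (forall x, a <= x <= b -> {for x, continuous U}) ->
  (forall x, a <= x < b -> exists E : R -> R,
     [/\ E x = U x, forall y, x <= y <= b -> E y <= U y & is_derive x 1 E 0]) ->
  U a <= U b.
Proof.
move=> ab cU mU.
suff H e : 0 < e -> U a <= U b + e * (b - a).
  have [->//|ab'] := eqVneq a b.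
  apply/ler_addgt0Pr => e e0.
  have ba0 : 0 < b - a by rewrite subr_gt0 lt_neqAle ab' ab.
  by have := H (e / (b - a)); rewrite divfK ?gt_eqF//; apply; rewrite divr_gt0.
move=> e0; pose V x := U x + e * (x - a).
have cV x : a <= x <= b -> {for x, continuous V}.
  move=> xab; apply: cvgD; first exact: cU.
  by apply: cvgM; [exact: cvg_cst|apply: cvgB; [exact: cvg_id|exact: cvg_cst]].
pose S := [set x | a <= x <= b /\ V a <= V x].
have Sa : S a by split; rewrite ?lexx.
have Sb : ubound S b by move=> x [/andP[]].
have supS : has_sup S by split; [exists a|exists b].
set s := sup S.
have sab : a <= s <= b.
  by rewrite /s ub_le_sup//=; [rewrite ge_sup//; exists a|exists b].
have Vs : V a <= V s.
  rewrite leNgt; apply/negP => Vsa.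
  have [d /= d0 Hd] : \forall x \near s, V x < V a.
    by apply: (cvgr_lt (V s) (cV s sab)).
  have [x Sx sx] := sup_adherent d0 supS.
  have xs : x <= s by apply: ub_le_sup => //; exists b.
  have : V x < V a.
    apply: Hd; rewrite /ball/= ger0_norm ?subr_ge0//.
    by rewrite ltrBlDr -ltrBlDl.
  by case: Sx => _; rewrite ltNge => ->.
suff -> : b = s by move: Vs; rewrite /V subrr mulr0 addr0.
apply/eqP; rewrite eq_le; case/andP: (sab) => as_ ->; rewrite andbT leNgt.
apply/negP => sb.
have [E [Es EU dE]] := mU s (introT andP (conj as_ sb)).
have [d /= d0 Hd] : \forall h \near 0^', `|h^-1 *: (E (h *: 1 + s) - E s)| < e.
  have [dE1 dE2] := dE.
  have /cvgr0Pnorm_lt : h^-1 *: ((E \o shift s) (h *: 1) - E s) @[h -->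
    0^'] --> 0.
    by rewrite -[X in _ --> X]dE2; exact: dE1.
  by apply.
pose h := Num.min (d / 2) (b - s).
have h0 : 0 < h by rewrite lt_min divr_gt0//= subr_gt0.
have hd : h < d by rewrite gt_min ltr_pdivrMr// ltr_pMr// ltr1n.
have hb : h + s <= b by rewrite -lerBrDr ge_min lexx orbT.
have : `|h^-1 *: (E (h *: 1 + s) - E s)| < e.
  by apply: Hd => /=; rewrite ?gt_eqF// sub0r normrN gtr0_norm.
rewrite /GRing.scale/= mulr1 normrM gtr0_norm ?invr_gt0// ltr_pdivrMl// => Eh.
have hs : s < h + s by rewrite ltrDr.
have : S (h + s).
  split; first by rewrite hb andbT (le_trans as_)// ltW.
  apply: (le_trans Vs); rewrite /V.
  have : E (h + s) <= U (h + s) by apply: EU; rewrite hb ltW.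
  have : - (h * e) <= E (h + s) - E s.
    by rewrite lerNl; apply: (le_trans (ler_norm _)); rewrite normrN ltW.
  rewrite Es; lra.
move=> Shs; have : h + s <= s by apply: ub_le_sup => //; exists b.
by rewrite leNgt hs.
Qed.


Notation mu := (@lebesgue_measure R).

(** W minus a primitive of w has minorants of derivative 0. *)
Lemma integral_le_of_minorants (W w : R -> R) (a b : R) : 0 < a -> a <= b ->
  (forall x : R, 0 < x -> {for x, continuous W}) ->
  (forall x : R, 0 < x -> {for x, continuous w}) ->
  (forall x : R, 0 < x -> exists E : R -> R,
     [/\ E x = W x, forall y : R, x <= y -> E y <= W y & is_derive x 1 E (w x)]) ->
  mu.-integrable `]0, +oo[ (EFin \o w) ->
  \int[mu]_(x in `]a, b]) w x <= W b - W a.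
Proof.
move=> a0 ab cW cw mW intw.
have intwr (x : R) : mu.-integrable `]0, x] (EFin \o w).
  by apply: (integrableS _ _ _ intw) => //; apply: subset_itvl.
pose F (x : R) := \int[mu]_(t in `]0, x]) w t.
have dF (x : R) : 0 < x -> is_derive x 1 F (w x).
  move=> x0.
  have xx1 : x < x + 1 by rewrite ltrDl.
  have lt0x : (BRight 0%R < BRight x)%O by rewrite bnd_simp.
  have [dFx Fx] := @continuous_FTC1 R w _ x _ xx1 (intwr _) lt0x (cw x x0).
  by apply: (DeriveDef dFx); rewrite -derive1E.
have -> : \int[mu]_(x in `]a, b]) w x = F b - F a.
  by rewrite /F Rintegral_itvB// bnd_simp// ltW.
suff : W a - F a <= W b - F b by lra.
apply: (@le_of_minorants (fun x => W x - F x)) => // x /andP[ax xb].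
  have x0 : 0 < x by apply: lt_le_trans ax.
  apply: cvgB; first exact: cW.
  apply: differentiable_continuous; apply/derivable1_diffP.
  by have [] := dF x x0.
have x0 : 0 < x by apply: lt_le_trans ax.
have [E [Ex EW dE]] := mW x x0.
exists (fun y => E y - F y); split.
- by rewrite Ex.
- by move=> y /andP[xy _]; rewrite lerB// EW.
- have dFx := dF x x0.
  by apply: is_derive_eq; rewrite subrr.
Qed.

(** Integration over a half line of a lower bound w for the slope of W, when W
   vanishes at both ends. Only minorants of W are differentiated: W stands for
   a function built on a profile whose derivative has no upper bound. *)
Lemma integral_le0_of_minorants (W w : R -> R) :
  (forall x : R, 0 < x -> {for x, continuous W}) ->
  (forall x : R, 0 < x -> {for x, continuous w}) ->
  (forall x : R, 0 < x -> exists E : R -> R,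
     [/\ E x = W x, forall y : R, x <= y -> E y <= W y & is_derive x 1 E (w x)]) ->
  mu.-integrable `]0, +oo[ (EFin \o w) ->
  W x @[x --> 0^'+] --> 0 -> W x @[x --> +oo] --> 0 ->
  (\int[mu]_(x in `]0%R, +oo[) (w x)%:E <= 0)%E.
Proof.
move=> cW cw mW intw W0 Woo.
pose I (n : nat) : set R := `]n.+1%:R^-1, n.+1%:R]%classic.
have Ipos n : I n `<=` `]0, +oo[.
  move=> x; rewrite /I /= !in_itv/= andbT => /andP[+ _].
  by apply: lt_trans; rewrite invr_gt0.
have mw : measurable_fun (`]0, +oo[%classic : set R) w.
  by have /measurable_EFinP := measurable_int _ intw.
have [||||| _ _ +] := @dominated_convergence _ _ _ mu `]0,
  +oo[ (measurable_itv _)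
  (fun n x => (w x * \1_(I n) x)%:E) (EFin \o w) (fun x => `|w x|%:E).
- move=> n; apply/measurable_EFinP/measurable_funM => //.
  by apply: measurable_indic; exact: measurable_itv.
- exact: measurable_int intw.
- apply: aeW => x; rewrite /= in_itv/= andbT => x0.
  apply: cvg_near_cst.
  near=> n; rewrite indicE mem_set ?mulr1// /I /= in_itv/=; apply/andP; split.
    rewrite invf_plt ?posrE// -[X in _ < X]natr1.
    by rewrite (lt_le_trans (_ : _ < n%:R)) ?lerDl//; near: n;
      exact: nbhs_infty_gtr.
  rewrite -natr1 (le_trans (_ : _ <= n%:R)) ?lerDl//; near: n;
    exact: nbhs_infty_ger.
- exact: (integrable_abse intw).
- apply: aeW => x n _; rewrite /= lee_fin normrM ler_piMr// ger0_norm//.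
have IE n : (\int[mu]_(x in `]0%R, +oo[) (w x * \1_(I n) x)%:E <= (W n.+1%:R -
  W n.+1%:R^-1)%:E)%E.
  have an0 : 0 < n.+1%:R^-1 :> R by rewrite invr_gt0.
  have ab : n.+1%:R^-1 <= n.+1%:R :> R.
    by apply: (@le_trans _ _ 1); rewrite ?invf_le1 ?ler1n.
  rewrite (_ : \int[mu]_(x in _) _ = \int[mu]_(x in I n) (w x)%:E)%E;
    last first.
    rewrite -[in RHS](setIidr (Ipos n)) [RHS]integral_mkcondr.
    apply: eq_integral => x _; rewrite patchE indicE.
    by case: ifP => _; rewrite ?mulr1 ?mulr0.
  rewrite -(@fineK _ (\int[mu]_(x in I n) (w x)%:E)%E); last first.
    apply: integrable_fin_num => //; first exact: measurable_itv.
    by apply: (integrableS _ _ _ intw) => //; exact: measurable_itv.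
  rewrite lee_fin; exact: integral_le_of_minorants.
move=> cvI; apply: (@lee_cvg_to _ _ _ _ _ (fun n => (W n.+1%:R - W
  n.+1%:R^-1)%:E) _ _ cvI); last first.
  by apply: nearW => n; exact: IE.
apply: cvg_EFin; first by near=> n.
rewrite -[X in _ --> X](subrr 0); apply: cvgB.
  apply: (cvg_comp _ _ _ Woo); apply/cvgryPge => A; near=> n.
  rewrite -natr1 (le_trans (_ : _ <= n%:R)) ?lerDl//; near: n;
    exact: nbhs_infty_ger.
move/cvg_at_rightP : W0; apply; split => [n|]; first by rewrite invr_gt0.
exact: cvg_harmonic.
Unshelve. all: by end_near.
Qed.
End lower_slope.

(** * Derivative and second moment of the normal density *)

Section normal_density.
Context {R : realType}.
Notation mu := (@lebesgue_measure R).
Implicit Types m s x : R.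

Lemma is_derive_normal_pdf m s x : s != 0 ->
  is_derive x 1 (normal_pdf m s) (- ((x - m) / s ^+ 2 * normal_pdf m s x)).
Proof.
move=> s0; rewrite normal_pdfE// /normal_fun.
have H : is_derive x 1 (fun y : R => - (y - m) ^+ 2 / (s ^+ 2 *+ 2)) (- ((x -
  m) / s ^+ 2)).
  apply: is_derive_eq; rewrite /GRing.scale/=.
  by field.
apply: is_derive_eq; rewrite /GRing.scale/=.
ring.
Qed.

(** Doubling the deviation absorbs a quadratic factor, since
   t * exp (- t) <= 4 * exp (- t / 4). *)
Lemma sqr_normal_pdf_le m s x : 0 < s ->
  (x - m) ^+ 2 * normal_pdf m s x <=
  8 * s ^+ 2 * (normal_peak s / normal_peak (2 * s)) * normal_pdf m (2 * s) x.
Proof.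
move=> s0; rewrite !normal_pdfE ?gt_eqF ?mulr_gt0//.
have p2 : 0 < normal_peak (2 * s) by rewrite normal_peak_gt0// gt_eqF ?mulr_gt0.
have p1 : 0 < normal_peak s by rewrite normal_peak_gt0// gt_eqF.
rewrite [leRHS](_ : _ = 8 * s ^+ 2 * normal_peak s * normal_fun m (2 * s) x);
  last first.
  by field; rewrite gt_eqF.
rewrite /normal_fun; set t := (x - m) ^+ 2 / (s ^+ 2 *+ 2).
have t0 : 0 <= t by rewrite divr_ge0 ?sqr_ge0// mulrn_wge0// sqr_ge0.
have sn : s != 0 by rewrite gt_eqF.
have -> : - (x - m) ^+ 2 / (s ^+ 2 *+ 2) = - t by rewrite mulNr.
have -> : - (x - m) ^+ 2 / ((2 * s) ^+ 2 *+ 2) = - (t / 4) by rewrite /t; field.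
have -> : (x - m) ^+ 2 = 2 * s ^+ 2 * t by rewrite /t; field.
have te : t <= 4 * expR (3 * (t / 4)).
  apply: (@le_trans _ _ (4 * (1 + 3 * (t / 4)))); first by lra.
  by rewrite ler_pM2l// expR_ge1Dx.
have -> : expR (- (t / 4)) = expR (- t) * expR (3 * (t / 4)).
  by rewrite -expRD; congr expR; field.
have := expR_gt0 (- t); set e := expR (- t) => e0.
rewrite (_ : _ * (_ * e) = 2 * s ^+ 2 * normal_peak s * e * t); last by ring.
rewrite [leRHS](_ : _ = 2 * s ^+ 2 * normal_peak s * e * (4 * expR (3 * (t /
  4)))); last by ring.
by rewrite ler_pM2l// !mulr_gt0// exprn_gt0.
Qed.

Lemma integrable_sqr_normal_pdf m s : 0 < s ->
  mu.-integrable setT (fun x => ((x - m) ^+ 2 * normal_pdf m s x)%:E).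
Proof.
move=> s0; set K := 8 * s ^+ 2 * (normal_peak s / normal_peak (2 * s)).
apply: (le_integrable measurableT _ _ (integrableZl measurableT K
  (integrable_normal_pdf m (2 * s)))).
- apply/measurable_EFinP/measurable_funM; last exact: measurable_normal_pdf.
  by apply: measurable_funX; apply: measurable_funB.
- move=> x _; rewrite /= lee_fin.
  rewrite !ger0_norm; first exact: sqr_normal_pdf_le.
    rewrite mulr_ge0 ?normal_pdf_ge0// /K.
    by rewrite !mulr_ge0 ?exprn_ge0 ?invr_ge0 ?normal_peak_ge0// ltW.
  by rewrite mulr_ge0 ?normal_pdf_ge0 ?sqr_ge0.
Qed.

Lemma cvg_mul_normal_pdf m s : 0 < s ->
  (x - m) * normal_pdf m s x @[x --> +oo] --> 0.
Proof.
move=> s0.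
set B := 8 * s ^+ 2 * (normal_peak s / normal_peak (2 * s)) * normal_peak (2 *
  s).
have Boo : B / (x - m) @[x --> +oo] --> 0.
  rewrite -[X in _ --> X](mulr0 B); apply: cvgM; first exact: cvg_cst.
  apply/gtr0_cvgV0; last exact: cvg_addrr.
  by near do rewrite subr_gt0; apply: nbhs_pinfty_gt; exact: num_real.
apply: (squeeze_cvgr _ (cvg_cst 0) Boo); near=> x.
have xm : 0 < x - m by rewrite subr_gt0; near: x; apply: nbhs_pinfty_gt;
  exact: num_real.
apply/andP; split; first by rewrite mulr_ge0 ?normal_pdf_ge0// ltW.
rewrite ler_pdivlMr// mulrAC -expr2.
rewrite (le_trans (sqr_normal_pdf_le m x s0))// /B ler_pM2l; last first.
  have p c : 0 < c -> 0 < normal_peak c by move=> c0;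
    rewrite normal_peak_gt0// gt_eqF.
  have s2 : 0 < 2 * s by rewrite mulr_gt0.
  by rewrite mulr_gt0 ?divr_gt0 ?p// mulr_gt0// exprn_gt0.
by rewrite normal_pdf_ub// gt_eqF ?mulr_gt0.
Unshelve. all: by end_near. Qed.

Lemma cvg_normal_pdf m s : 0 < s -> normal_pdf m s x @[x --> +oo] --> 0.
Proof.
move=> s0.
apply: (squeeze_cvgr _ (cvg_cst 0) (cvg_mul_normal_pdf m s0)); near=> x.
rewrite normal_pdf_ge0/= ler_peMl ?normal_pdf_ge0// lerBrDr.
by near: x; apply: nbhs_pinfty_ge; exact: num_real.
Unshelve. all: by end_near. Qed.

(** This primitive, which vanishes at 0 and at infinity, is where the second
   moment comes from. *)
Lemma is_derive_mul_normal_pdf s x : s != 0 ->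
  is_derive x 1 (fun y => - (s ^+ 2 * (y * normal_pdf 0 s y)))
    ((x ^+ 2 - s ^+ 2) * normal_pdf 0 s x).
Proof.
move=> s0; have H := is_derive_normal_pdf 0 x s0.
apply: is_derive_eq; rewrite /GRing.scale/=.
by field.
Qed.

Lemma integral_sqr_normal_half s : 0 < s ->
  (\int[mu]_(x in `]0%R, +oo[) ((x ^+ 2 - s ^+ 2) * normal_pdf 0 s x)%:E = 0)%E.
Proof.
move=> s0; have sn : s != 0 by rewrite gt_eqF.
pose W y := - (s ^+ 2 * (y * normal_pdf 0 s y)).
pose w x := (x ^+ 2 - s ^+ 2) * normal_pdf 0 s x.
have cn (y : R) : {for y, continuous (normal_pdf 0 s)} by exact:
  continuous_normal_pdf.
have cW (y : R) : {for y, continuous W}.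
  apply: differentiable_continuous; apply/derivable1_diffP.
  by have [] := is_derive_mul_normal_pdf y sn.
have cw (y : R) : {for y, continuous w}.
  apply: cvgM; last exact: cn.
  apply: cvgB; last exact: cvg_cst.
  exact: exprn_continuous.
have W0 : W x @[x --> 0^'+] --> 0.
  have W00 : W 0 = 0 by rewrite /W mul0r mulr0 oppr0.
  by rewrite -[X in _ --> X]W00; apply: cvg_at_right_filter; exact: cW.
have Woo : W x @[x --> +oo] --> 0.
  rewrite -oppr0; apply: cvgN.
  rewrite -[X in _ --> X](mulr0 (s ^+ 2)); apply: cvgM; first exact: cvg_cst.
  by have := @cvg_mul_normal_pdf 0 s s0; under eq_cvg do rewrite subr0.
have intw : mu.-integrable `]0, +oo[ (EFin \o w).
  have H : mu.-integrable setT (EFin \o w).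
    rewrite (_ : _ \o _ = fun x => (((x - 0) ^+ 2 * normal_pdf 0 s x)%:E -
       ((s ^+ 2)%:E * (normal_pdf 0 s x)%:E))%E); last first.
      by apply/funext => x; rewrite subr0 /= -EFinB /w mulrBl.
    apply: integrableB => //; first exact: integrable_sqr_normal_pdf.
    exact/integrableZl/integrable_normal_pdf.
  by apply: (integrableS _ _ _ H).
apply/eqP; rewrite eq_le; apply/andP; split.
  apply: (@integral_le0_of_minorants _ W w) => // x x0.
  by exists W; split; [by []|by []|exact: is_derive_mul_normal_pdf].
rewrite -leeN2 oppe0 -integralN; last exact: integrable_add_def intw.
apply: (@integral_le0_of_minorants _ (fun x => - W x) (fun x => - w x)).
- by move=> x x0; apply: cvgN; exact: cW.
- by move=> x x0; apply: cvgN; exact: cw.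
- move=> x x0; exists (fun x => - W x); split; [by []|by []|].
  exact: (is_deriveN (is_derive_mul_normal_pdf x sn)).
- exact: (integrableN intw).
- by rewrite -[X in _ --> X]oppr0; apply: cvgN; exact: W0.
- by rewrite -[X in _ --> X]oppr0; apply: cvgN; exact: Woo.
Qed.

Lemma integral_sqr_normal_pdf s : 0 < s ->
  (\int[mu]_x (x ^+ 2 * normal_pdf 0 s x)%:E = (s ^+ 2)%:E)%E.
Proof.
move=> s0; have sn : s != 0 by rewrite gt_eqF.
have cn : continuous (normal_pdf 0 s) by exact: continuous_normal_pdf.
have even (x : R) : normal_pdf 0 s x = normal_pdf 0 s (- x).
  by rewrite -[in RHS]oppr0 normal_pdfN.
have half (f : R -> R) : (forall x, 0 <= f x) -> continuous f ->
    f =1 f \o -%R -> (\int[mu]_x (f x)%:E = 2%:E * \int[mu]_(x in `]0%R,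
      +oo[) (f x)%:E)%E.
  move=> f0 cf evenf; rewrite ge0_symfun_integralT// -set_itvcy.
  rewrite integral_itv_obnd_cbnd//; apply/measurable_EFinP/measurable_funTS.
  exact: continuous_measurable_fun.
have cx : continuous (fun x => x ^+ 2 * normal_pdf 0 s x).
  by move=> x; apply: cvgM; [exact: exprn_continuous|exact: cn].
have i1 : mu.-integrable `]0, +oo[ (fun x => (x ^+ 2 * normal_pdf 0 s x)%:E).
  have := integrable_sqr_normal_pdf 0 s0; under [X in _.-integrable _ X]eq_fun
    do rewrite subr0.
  by move=> H; apply: (integrableS _ _ _ H).
have i2 : mu.-integrable `]0, +oo[ (fun x => (normal_pdf 0 s x)%:E).
  by apply: (integrableS _ _ _ (integrable_normal_pdf 0 s)).
have i3 : mu.-integrable `]0, +oo[ (fun x => (s ^+ 2 * normal_pdf 0 s x)%:E).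
  by apply: (integrableZl _ (s ^+ 2) i2).
have := integral_sqr_normal_half s0.
under eq_integral do rewrite mulrBl EFinB.
rewrite integralB//= [X in (_ - X)%E](_ : _ = (s ^+ 2)%:E *
  \int[mu]_(x in `]0%R, +oo[) (normal_pdf 0 s x)%:E)%E; last first.
  by rewrite -integralZl//.
have := integral_normal_pdf 0 s; rewrite (half _ (normal_pdf_ge0 0 s) cn even).
rewrite (half _ _ cx); first last.
- by move=> x /=; rewrite sqrrN -even.
- by move=> x; rewrite mulr_ge0 ?sqr_ge0 ?normal_pdf_ge0.
rewrite -(fineK (integrable_fin_num _ i1))// -(fineK (integrable_fin_num _
  i2))//.
rewrite -!EFinM -EFinB => -[B2] [AB]; congr _%:E.
set A := fine _ in AB *; set B := fine _ in B2 AB.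
by rewrite (_ : A = s ^+ 2 * B); [rewrite mulrCA B2 mulr1|apply/eqP;
  rewrite -subr_eq0 AB].
Qed.

End normal_density.

(** * Moments and the one-dimensional Bayes risk *)

Section normal_moments.
Context {R : realType}.
Notation mu := (@lebesgue_measure R).
Implicit Types m s x : R.

Lemma ge0_integral_normal_translate m c s (f : R -> \bar R) : s != 0 ->
  measurable_fun setT f -> (forall x, 0 <= f x)%E ->
  (\int[normal_prob (m + c) s]_x f x = \int[normal_prob m s]_x f (x + c)%R)%E.
Proof.
move=> s0 mf f0.
rewrite (eq_measure_integral (pushforward (normal_prob m s) (translate c)));
  last first.
  by move=> B mB _; exact: normal_prob_translate.
rewrite ge0_integral_pushforward; first by rewrite preimage_setT.
- exact: measurable_translate.
- exact: measurableT.
- exact: mf.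
- by move=> x _.
Qed.

Lemma ge0_integral_normalN m s (f : R -> \bar R) : s != 0 ->
  measurable_fun setT f -> (forall x, 0 <= f x)%E ->
  (\int[normal_prob (- m) s]_x f x = \int[normal_prob m s]_x f (- x)%R)%E.
Proof.
move=> s0 mf f0.
rewrite (eq_measure_integral (pushforward (normal_prob m s) opp_line));
  last first.
  by move=> B mB _; exact: normal_probN.
rewrite ge0_integral_pushforward; first by rewrite preimage_setT.
- exact: measurable_opp_line.
- exact: measurableT.
- exact: mf.
- by move=> x _.
Qed.

Lemma normal_variance m s : 0 < s ->
  (\int[normal_prob m s]_x ((x - m) ^+ 2)%:E = (s ^+ 2)%:E)%E.
Proof.
move=> s0; rewrite -[X in normal_prob X](add0r m).
rewrite ge0_integral_normal_translate ?gt_eqF//; first last.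
- by move=> x; rewrite lee_fin sqr_ge0.
- apply/measurable_EFinP/measurable_funX; exact: measurable_funB.
rewrite ge0_integral_normal_prob//; first last.
- by move=> x; rewrite lee_fin sqr_ge0.
- apply/measurable_EFinP/measurable_funX; apply: measurable_funB => //.
  exact: measurable_funD.
rewrite -integral_sqr_normal_pdf//; apply: eq_integral => x _.
by rewrite addrK EFinM.
Qed.

(** The midpoint of a - x and its image under the reflection about the mean is
   a - m, so averaging the two squares leaves at least the variance. *)
Lemma normal_variance_le m s a : 0 < s ->
  ((s ^+ 2)%:E <= \int[normal_prob m s]_x ((a - x) ^+ 2)%:E)%E.
Proof.
move=> s0; have sn : s != 0 by rewrite gt_eqF.
have msq (b : R) : measurable_fun setT (fun x => ((b - x) ^+ 2)%:E).
  by apply/measurable_EFinP/measurable_funX; exact: measurable_funB.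
have sq0 (b x : R) : (0 <= ((b - x) ^+ 2)%:E)%E by rewrite lee_fin sqr_ge0.
have refl : (\int[normal_prob m s]_x ((a - x) ^+ 2)%:E =
    \int[normal_prob m s]_x ((a - m - m + x) ^+ 2)%:E)%E.
  have {1}-> : m = - m + (m + m) by ring.
  rewrite (ge0_integral_normal_translate _ _ sn (msq a) (sq0 a)).
  rewrite (ge0_integral_normalN _ sn _ (fun x => sq0 a (x + (m + m))));
    last first.
    apply/measurable_EFinP/measurable_funX; apply: measurable_funB => //.
    exact: measurable_funD.
  by apply: eq_integral => x _; congr (_ ^+ 2)%:E; ring.
set I := (\int[_]_x _)%E.
suff : ((s ^+ 2 + s ^+ 2)%:E <= I + I)%E.
  case: I refl => [r _| |] //=; rewrite -?EFinD ?leey// !lee_fin; lra.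
pose v (x : measurableTypeR R) := ((x - m) ^+ 2)%:E;
  pose g1 (x : measurableTypeR R) := ((a - x) ^+ 2)%:E.
pose g2 (x : measurableTypeR R) := ((a - m - m + x) ^+ 2)%:E.
have mv : measurable_fun setT v.
  by apply/measurable_EFinP/measurable_funX; exact: measurable_funB.
have mg2 : measurable_fun setT g2.
  by apply/measurable_EFinP/measurable_funX; exact: measurable_funD.
have mg1 : measurable_fun setT g1 by exact: msq.
have g10 x : (0 <= g1 x)%E by rewrite lee_fin sqr_ge0.
have v0 x : (0 <= v x)%E by rewrite lee_fin sqr_ge0.
have g20 x : (0 <= g2 x)%E by rewrite lee_fin sqr_ge0.
have -> : (I + I = \int[normal_prob m s]_x (g1 x + g2 x))%E.
  transitivity (I + \int[normal_prob m s]_x g2 x)%E; first by congr (_ + _)%E;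
    exact: refl.
  apply/esym; rewrite ge0_integralD; [exact: erefl|exact: measurableT|
    by move=> x _; exact: g10|exact: mg1|by move=> x _; exact: g20|exact: mg2].
have -> : ((s ^+ 2 + s ^+ 2)%:E = \int[normal_prob m s]_x (v x + v x))%E.
  rewrite ge0_integralD; [by rewrite EFinD /v normal_variance|exact:
    measurableT|
    by move=> x _; exact: v0|exact: mv|by move=> x _; exact: v0|exact: mv].
apply: ge0_le_integral.
- exact: measurableT.
- by move=> x _; exact: adde_ge0.
- exact: emeasurable_funD.
- exact: (emeasurable_funD mg1).
- move=> x _; rewrite /v /g1 /g2 -!EFinD lee_fin.
  have := sqr_ge0 (a - m); nra.
Qed.

(** Completing the square: the joint density of the mean t and the observation y
   is the posterior density of t given y times the marginal density of y. *)
Lemma normal_pdf_bayes (t y s tau : R) : 0 < s -> 0 < tau ->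
  let S := Num.sqrt (s ^+ 2 + tau ^+ 2) in
  normal_pdf t s y * normal_pdf 0 tau t =
  normal_pdf (tau ^+ 2 / S ^+ 2 * y) (s * tau / S) t * normal_pdf 0 S y.
Proof.
move=> s0 tau0 S.
have S2 : S ^+ 2 = s ^+ 2 + tau ^+ 2 by rewrite sqr_sqrtr// addr_ge0 ?sqr_ge0.
have S2p : 0 < s ^+ 2 + tau ^+ 2 by rewrite addr_gt0 ?exprn_gt0.
have S0 : 0 < S by rewrite sqrtr_gt0.
rewrite !normal_pdfE ?gt_eqF ?divr_gt0 ?mulr_gt0// /normal_fun.
rewrite mulrACA [RHS]mulrACA -!expRD; congr (_ * expR _).
  rewrite /normal_peak -!invfM -!sqrtrM; last 2 first.
  - by rewrite mulrn_wge0// mulr_ge0 ?sqr_ge0 ?pi_ge0.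
  - by rewrite mulrn_wge0// mulr_ge0 ?sqr_ge0 ?pi_ge0.
  congr (Num.sqrt _)^-1; rewrite expr_div_n S2; field.
  by rewrite gt_eqF.
rewrite expr_div_n S2 !subr0.
by field; rewrite !gt_eqF.
Qed.

(** The posterior law of the mean has variance
   (s * tau)^2 / (s^2 + tau^2) whatever the observation, and no guess has a
   smaller posterior mean squared error. *)
Lemma normal_bayes_risk (f : R -> R) s tau : 0 < s -> 0 < tau ->
  measurable_fun setT f ->
  (((s * tau) ^+ 2 / (s ^+ 2 + tau ^+ 2))%:E <=
   \int[normal_prob 0 tau]_t \int[normal_prob 0 s]_x ((f (x + t) - t) ^+
     2)%:E)%E.
Proof.
move=> s0 tau0 mf; pose S := Num.sqrt (s ^+ 2 + tau ^+ 2).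
have S2 : S ^+ 2 = s ^+ 2 + tau ^+ 2 by rewrite sqr_sqrtr// addr_ge0 ?sqr_ge0.
have S2p : 0 < s ^+ 2 + tau ^+ 2 by rewrite addr_gt0 ?exprn_gt0.
have S0 : 0 < S by rewrite sqrtr_gt0.
have v0 : 0 < s * tau / S by rewrite divr_gt0// mulr_gt0.
have sn : s != 0 by rewrite gt_eqF.
pose k (t y : R) := (f y - t) ^+ 2 * normal_pdf t s y.
pose K (ty : measurableTypeR R * measurableTypeR R) :=
  (k ty.1 ty.2 * normal_pdf 0 tau ty.1)%:E.
have kE t y : k t y = (f y - t) ^+ 2 * normal_pdf 0 s (y - t).
  by rewrite /k -(normal_pdf_translate 0 t _ sn) add0r subrK.
have k0 t y : 0 <= k t y by rewrite mulr_ge0 ?sqr_ge0 ?normal_pdf_ge0.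
have K0 ty : (0 <= K ty)%E by rewrite lee_fin mulr_ge0 ?normal_pdf_ge0.
have mk : measurable_fun setT (fun ty : measurableTypeR R * measurableTypeR R
  => k ty.1 ty.2).
  under eq_fun do rewrite kE.
  apply: measurable_funM.
    apply: measurable_funX; apply: measurable_funB; last exact: measurable_fst.
    by apply: (measurableT_comp mf); exact: measurable_snd.
  apply: (measurableT_comp (measurable_normal_pdf 0 s)).
  by apply: measurable_funB; [exact: measurable_snd|exact: measurable_fst].
have mK : measurable_fun setT K.
  apply/measurable_EFinP/measurable_funM => //.
  by apply: (measurableT_comp (measurable_normal_pdf 0 tau));
    exact: measurable_fst.
have msq t : measurable_fun setT (fun y : measurableTypeR R => ((f y - t) ^+
  2)%:E).
  by apply/measurable_EFinP/measurable_funX; exact: measurable_funB.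
have innerE t : (\int[normal_prob 0 s]_x ((f (x + t) - t) ^+ 2)%:E =
    \int[mu]_y (k t y)%:E)%E.
  rewrite -(@ge0_integral_normal_translate 0 t s (fun y => ((f y - t) ^+ 2)%:E)
    sn (msq t)); last first.
    by move=> y; rewrite lee_fin sqr_ge0.
  rewrite add0r ge0_integral_normal_prob; [|exact: measurableT|exact: msq|];
    last first.
    by move=> y; rewrite lee_fin sqr_ge0.
  by apply: eq_integral => y _; rewrite -EFinM.
under eq_integral do rewrite innerE.
have mkE : measurable_fun setT (fun ty : measurableTypeR R * measurableTypeR R
  => (k ty.1 ty.2)%:E).
  exact/measurable_EFinP.
rewrite ge0_integral_normal_prob; first last.
- by move=> t; apply: integral_ge0 => y _; rewrite lee_fin.
- have := @measurable_fun_fubini_tonelli_F _ _ _ _ R mu _ mkE.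
  by apply => ty; rewrite lee_fin.
- exact: measurableT.
rewrite [leRHS](_ : _ = \int[mu]_t \int[mu]_y K (t, y))%E; last first.
  apply: eq_integral => t _; rewrite -ge0_integralZr.
  - by apply: eq_integral => y _; rewrite /K EFinM.
  - exact: measurableT.
  - by apply/measurable_EFinP; exact: (measurableT_comp mk (pair1_measurable
    t)).
  - by move=> y _; rewrite lee_fin.
  - by rewrite lee_fin normal_pdf_ge0.
rewrite fubini_tonelli//.
rewrite [leLHS](_ : _ = \int[mu]_y (((s * tau / S) ^+ 2)%:E * (normal_pdf 0 S
  y)%:E))%E; last first.
  rewrite integralZl//; last exact: integrable_normal_pdf.
  by rewrite integral_normal_pdf mule1 expr_div_n S2.
apply: ge0_le_integral.
- exact: measurableT.
- by move=> y _; rewrite -EFinM lee_fin mulr_ge0 ?normal_pdf_ge0 ?sqr_ge0.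
- by apply/measurable_EFinP/measurable_funM => //; exact: measurable_normal_pdf.
- exact: measurable_fun_fubini_tonelli_G.
move=> y _; rewrite (_ : (\int[mu]_t K (t, y) =
   \int[normal_prob (tau ^+ 2 / S ^+ 2 * y) (s * tau / S)]_t ((f y - t) ^+
     2)%:E *
   (normal_pdf 0 S y)%:E)%E); last first.
  rewrite ge0_integral_normal_prob; [|exact: measurableT| |]; first last.
  - by move=> t; rewrite lee_fin sqr_ge0.
  - by apply/measurable_EFinP/measurable_funX; exact: measurable_funB.
  rewrite -ge0_integralZr; first last.
  - by rewrite lee_fin normal_pdf_ge0.
  - by move=> t _; rewrite -EFinM lee_fin mulr_ge0 ?normal_pdf_ge0 ?sqr_ge0.
  - apply/measurable_EFinP/measurable_funM; last exact: measurable_normal_pdf.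
    by apply: measurable_funX; exact: measurable_funB.
  - exact: measurableT.
  apply: eq_integral => t _; rewrite /K /k/= -mulrA normal_pdf_bayes// -/S
    mulrA.
  by rewrite !EFinM.
by rewrite lee_wpmul2r ?lee_fin ?normal_pdf_ge0// normal_variance_le.
Qed.

End normal_moments.

(** * Every estimator has worst-case risk at least the dimension *)

Section minimax_lower_bound.
Context {R : realType}.
Implicit Types (n : nat) (s tau : R).

Definition vzero n : vec R n := [tuple 0 | i < n].

(** The observation as mean plus noise: under this map prior and noise are
   independent, and Tonelli's theorem applies to the average risk. *)
Definition vadd n (theta z : vec R n) : vec R n :=
  [tuple tnth z i + tnth theta i | i < n].

Lemma measurable_vadd_pair n :
  measurable_fun setT (fun tz : vec R n * vec R n => vadd tz.1 tz.2).
Proof.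
apply/measurable_fun_tnthP => i.
rewrite (_ : _ \o _ = fun tz : vec R n * vec R n => tnth tz.2 i + tnth tz.1 i);
  last first.
  by apply/funext => tz /=; rewrite tnth_mktuple.
apply: measurable_funD.
  by apply: (measurableT_comp (measurable_tnth i)); exact: measurable_snd.
by apply: (measurableT_comp (measurable_tnth i)); exact: measurable_fst.
Qed.

Lemma measurable_vadd n (theta : vec R n) : measurable_fun setT (vadd theta).
Proof.
apply/measurable_fun_tnthP => i.
rewrite (_ : _ \o _ = fun z : vec R n => tnth z i + tnth theta i); last first.
  by apply/funext => z /=; rewrite tnth_mktuple.
by apply: measurable_funD => //; exact: measurable_tnth.
Qed.

HB.instance Definition _ n (theta : vec R n) :=
  isMeasurableFun.Build _ _ _ _ (vadd theta) (measurable_vadd theta).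

Lemma vadd_upd n (theta z : vec R n) i t x :
  vadd (upd theta i t) (upd z i x) = upd (vadd theta z) i (x + t).
Proof.
by apply: eq_from_tnth => j; rewrite !tnth_mktuple; case: eqP.
Qed.

Lemma normal_vec_translate n s (theta : vec R n) B : s != 0 -> measurable B ->
  normal_vec s theta B = distribution (normal_vec s (vzero n)) (vadd theta) B.
Proof.
move=> s0 mB; apply: box_measure_unique => // A mA.
rewrite normal_vec_box// /distribution /pushforward /=.
transitivity (normal_vec s (vzero n) (vadd theta @^-1` box A)); last by [].
rewrite (_ : _ @^-1` _ = box (fun i => translate (tnth theta i) @^-1` A i));
  last first.
  apply/seteqP; split => z /=.
    by move=> Az i; have := Az i; rewrite tnth_mktuple.
  by move=> Az i; rewrite tnth_mktuple; exact: Az.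
have mA' i : measurable (translate (tnth theta i) @^-1` A i).
  by rewrite -[X in measurable X]setTI; exact: measurable_translate.
rewrite [RHS](normal_vec_box s (vzero n) mA'); apply: eq_bigr => i _.
rewrite /vzero tnth_mktuple.
by have := normal_prob_translate 0 (tnth theta i) s0 (mA i); rewrite add0r.
Qed.

Lemma ge0_integral_normal_vec n s (theta : vec R n) (f : vec R n -> \bar R) :
  s != 0 -> measurable_fun setT f -> (forall z, 0 <= f z)%E ->
  (\int[normal_vec s theta]_z f z =
   \int[normal_vec s (vzero n)]_z f (vadd theta z))%E.
Proof.
move=> s0 mf f0.
rewrite (eq_measure_integral _ (fun B mB _ => normal_vec_translate theta s0
  mB)).
by rewrite ge0_integral_distribution.
Qed.

Lemma measurable_upd1 n (z : vec R n) i :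
  measurable_fun setT (fun x : measurableTypeR R => upd z i x).
Proof.
apply/measurable_fun_tnthP => j.
rewrite (_ : _ \o _ = fun x => if j == i then x else tnth z j); last first.
  by apply/funext => x /=; rewrite tnth_mktuple.
by case: eqP => _; [exact: measurable_id|exact: measurable_cst].
Qed.

(** Resampling the i-th coordinate of both the mean and the noise, with all the
   others frozen, leaves a one-dimensional Bayes problem. *)
Lemma bayes_risk_coordinate n s tau (i : 'I_n) (delta : vec R n -> vec R n) :
  0 < s -> 0 < tau -> measurable_fun setT delta ->
  (((s * tau) ^+ 2 / (s ^+ 2 + tau ^+ 2))%:E <=
   \int[normal_vec tau (vzero n)]_theta \int[normal_vec s (vzero n)]_z
     ((tnth (delta (vadd theta z)) i - tnth theta i) ^+ 2)%:E)%E.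
Proof.
move=> s0 tau0 mdelta.
pose h (tz : vec R n * vec R n) :=
  ((tnth (delta (vadd tz.1 tz.2)) i - tnth tz.1 i) ^+ 2)%:E.
have h0 tz : (0 <= h tz)%E by rewrite lee_fin sqr_ge0.
have mh : measurable_fun setT h.
  apply/measurable_EFinP/measurable_funX; apply: measurable_funB.
    apply: (measurableT_comp (measurable_tnth i));
      apply: (measurableT_comp mdelta).
    exact: measurable_vadd_pair.
  by apply: (measurableT_comp (measurable_tnth i)); exact: measurable_fst.
have mh1 theta : measurable_fun setT (fun z => h (theta, z)).
  exact: (measurableT_comp mh (pair1_measurable theta)).
have mI : measurable_fun setT (fun theta : vec R n => \int[normal_vec s (vzero
  n)]_z h (theta, z))%E.
  exact: (measurable_fun_fubini_tonelli_F h mh).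
have I0 (theta : vec R n) : (0 <= \int[normal_vec s (vzero n)]_z h (theta,
  z))%E.
  by apply: integral_ge0.
rewrite (ge0_integral_resample tau (vzero n) i mI I0).
have z0 : tnth (vzero n) i = 0 by rewrite tnth_mktuple.
rewrite z0; set c := ((s * tau) ^+ 2 / (s ^+ 2 + tau ^+ 2))%:E.
have c0 : (0 <= c)%E.
  by rewrite lee_fin divr_ge0 ?sqr_ge0// addr_ge0 ?sqr_ge0.
rewrite [leLHS](_ : _ = \int[normal_vec tau (vzero n)]_theta cst c theta)%E;
  last first.
  by rewrite integral_cst; [rewrite /= probability_setT mule1|exact:
    measurableT].
apply: ge0_le_integral.
- exact: measurableT.
- by move=> theta _; exact: c0.
- exact: measurable_cst.
- have mJ : measurable_fun setT (fun tx : vec R n * measurableTypeR R =>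
      \int[normal_vec s (vzero n)]_z h (upd tx.1 i tx.2, z))%E.
    exact: (measurableT_comp mI (measurable_upd i)).
  exact: (measurable_fun_fubini_tonelli_F _ mJ).
move=> theta _.
pose g (tzx : (measurableTypeR R * vec R n) * measurableTypeR R) :=
  h (upd theta i tzx.1.1, upd tzx.1.2 i tzx.2).
have mg : measurable_fun setT g.
  apply: (measurableT_comp mh); apply/measurable_fun_pairP; split.
    apply: (measurableT_comp (measurable_upd1 theta i)).
    by apply: (measurableT_comp measurable_fst); exact: measurable_fst.
  have mp : measurable_fun setT (fun tzx : (measurableTypeR R * vec R n) *
    measurableTypeR R => (tzx.1.2, tzx.2)).
    apply/measurable_fun_pairP; split; last exact: measurable_snd.
    by apply: (measurableT_comp measurable_snd); exact: measurable_fst.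
  exact: (measurableT_comp (measurable_upd i) mp).
have g0 tzx : (0 <= g tzx)%E by exact: h0.
pose q (tz : measurableTypeR R * vec R n) := (\int[normal_prob 0 s]_x g (tz,
  x))%E.
have mq : measurable_fun setT q by exact: (measurable_fun_fubini_tonelli_F g
  mg).
have q0 tz : (0 <= q tz)%E by apply: integral_ge0 => x _; exact: g0.
rewrite [leRHS](_ : _ = \int[normal_prob 0 tau]_t \int[normal_vec s (vzero
  n)]_z q (t, z))%E; last first.
  apply: eq_integral => t _.
  rewrite (ge0_integral_resample s (vzero n) i (mh1 (upd theta i t)));
    last first.
    by move=> z; exact: h0.
  by apply: eq_integral => z _; rewrite z0.
rewrite (fubini_tonelli q mq q0).
rewrite [leLHS](_ : _ = \int[normal_vec s (vzero n)]_z cst c z)%E; last first.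
  by rewrite integral_cst; [rewrite /= probability_setT mule1|exact:
    measurableT].
apply: ge0_le_integral.
- exact: measurableT.
- by move=> z _; exact: c0.
- exact: measurable_cst.
- exact: (measurable_fun_fubini_tonelli_G q mq).
move=> z _.
pose f (y : R) := tnth (delta (upd (vadd theta z) i y)) i.
have mf : measurable_fun setT f.
  apply: (measurableT_comp (measurable_tnth i));
    apply: (measurableT_comp mdelta).
  exact: measurable_upd1.
have := normal_bayes_risk s0 tau0 mf; congr (_ <= _)%E.
apply: eq_integral => t _; apply: eq_integral => x _.
by rewrite /g /h /= vadd_upd /f {2}/upd tnth_mktuple eqxx.
Qed.

Lemma measurable_loss_pair n s (delta : vec R n -> vec R n) :
  measurable_fun setT delta ->
  measurable_fun setT (fun tz : vec R n * vec R n => loss s (delta tz.2) tz.1).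
Proof.
move=> mdelta; apply: measurable_sum => i.
apply: measurable_funM => //; apply: measurable_funX; apply: measurable_funB.
  apply: (measurableT_comp (measurable_tnth i));
    apply: (measurableT_comp mdelta).
  exact: measurable_snd.
by apply: (measurableT_comp (measurable_tnth i)); exact: measurable_fst.
Qed.

Lemma loss_ge0 n s (a theta : vec R n) : 0 <= loss s a theta.
Proof. by apply: sumr_ge0 => i _; rewrite divr_ge0 ?sqr_ge0. Qed.

Lemma average_risk_ge n s tau (delta : vec R n -> vec R n) :
  0 < s -> 0 < tau -> measurable_fun setT delta ->
  ((n%:R * (tau ^+ 2 / (s ^+ 2 + tau ^+ 2)))%:E <=
   \int[normal_vec tau (vzero n)]_theta \int[normal_vec s theta]_z
     (loss s (delta z) theta)%:E)%E.
Proof.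
move=> s0 tau0 mdelta; have sn : s != 0 by rewrite gt_eqF.
pose h i (tz : vec R n * vec R n) :=
  ((tnth (delta (vadd tz.1 tz.2)) i - tnth tz.1 i) ^+ 2)%:E.
have h0 i tz : (0 <= h i tz)%E by rewrite lee_fin sqr_ge0.
have mh i : measurable_fun setT (h i).
  apply/measurable_EFinP/measurable_funX; apply: measurable_funB.
    apply: (measurableT_comp (measurable_tnth i));
      apply: (measurableT_comp mdelta).
    exact: measurable_vadd_pair.
  by apply: (measurableT_comp (measurable_tnth i)); exact: measurable_fst.
have mh1 i theta : measurable_fun setT (fun z => h i (theta, z)).
  exact: (measurableT_comp (mh i) (pair1_measurable theta)).
have s2 : (0 <= (s ^- 2)%:E)%E by rewrite lee_fin invr_ge0 sqr_ge0.
have E1 theta : (\int[normal_vec s theta]_z (loss s (delta z) theta)%:E =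
    \sum_(i < n) (s ^- 2)%:E * \int[normal_vec s (vzero n)]_z h i (theta, z))%E.
  rewrite ge0_integral_normal_vec; [|exact: sn| |]; last 2 first.
  - apply/measurable_EFinP.
    exact: (measurableT_comp (measurable_loss_pair s mdelta) (pair1_measurable
      theta)).
  - by move=> z; rewrite lee_fin loss_ge0.
  under eq_integral do rewrite /loss -sumEFin.
  rewrite ge0_integral_sum; [|exact: measurableT| |]; last 2 first.
  - move=> i; apply/measurable_EFinP/measurable_funM => //;
    apply/measurable_EFinP.
    exact: mh1.
  - by move=> i z _; rewrite lee_fin divr_ge0 ?sqr_ge0.
  apply: eq_bigr => i _; rewrite -ge0_integralZl//.
  by apply: eq_integral => z _; rewrite /h -EFinM mulrC.
under eq_integral do rewrite E1.
have mI i : measurable_fun setT (fun theta : vec R n => \int[normal_vec s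
  (vzero n)]_z h i (theta, z))%E.
  exact: (measurable_fun_fubini_tonelli_F (h i) (mh i)).
have I0 i (theta : vec R n) : (0 <= \int[normal_vec s (vzero n)]_z h i (theta,
  z))%E.
  by apply: integral_ge0.
rewrite ge0_integral_sum; [|exact: measurableT| |]; last 2 first.
- by move=> i; exact: measurable_funeM.
- by move=> i theta _; exact: mule_ge0.
rewrite [leLHS](_ : _ = \sum_(i < n) (s ^- 2)%:E * ((s * tau) ^+ 2 / (s ^+ 2 +
  tau ^+ 2))%:E)%E.
  apply: lee_sum => i _; rewrite ge0_integralZl//.
  by rewrite lee_wpmul2l// bayes_risk_coordinate.
rewrite -EFinM sumEFin sumr_const card_ord mulr_natl; congr (_ *+ _)%:E.
by field; rewrite sn gt_eqF// addr_gt0 ?exprn_gt0.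
Qed.

(** The worst-case risk is at least every average risk, and the lower bound
   for the average risk tends to n as the deviation tau of the prior grows. *)
Lemma sup_risk_ge n s (delta : vec R n -> vec R n) :
  0 < s -> measurable_fun setT delta ->
  (n%:R%:E <= ereal_sup (range (fun theta =>
     \int[normal_vec s theta]_z (loss s (delta z) theta)%:E)))%E.
Proof.
move=> s0 mdelta; set S := ereal_sup _.
have bound tau : 0 < tau -> ((n%:R * (tau ^+ 2 / (s ^+ 2 + tau ^+ 2)))%:E <=
  S)%E.
  move=> tau0; apply: (le_trans (average_risk_ge s0 tau0 mdelta)).
  have S0 : (0 <= S)%E.
    apply: (@le_trans _ _ (\int[normal_vec s (vzero n)]_z (loss s (delta z)
      (vzero n))%:E)%E).
      by apply: integral_ge0 => z _; rewrite lee_fin loss_ge0.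
    by apply: ereal_sup_ubound; exists (vzero n).
  rewrite [leRHS](_ : _ = \int[normal_vec tau (vzero n)]_theta cst S theta)%E;
    last first.
    by rewrite integral_cst; [rewrite /= probability_setT mule1|exact:
      measurableT].
  apply: ge0_le_integral.
  - exact: measurableT.
  - by move=> theta _; apply: integral_ge0 => z _; rewrite lee_fin loss_ge0.
  - rewrite (_ : (fun _ => _) = (fun theta : vec R n =>
        \int[normal_vec s (vzero n)]_z (loss s (delta (vadd theta z))
          theta)%:E)%E); last first.
      apply/funext => theta; rewrite ge0_integral_normal_vec//;
        first by rewrite gt_eqF.
      - apply/measurable_EFinP.
        exact: (measurableT_comp (measurable_loss_pair s mdelta)
          (pair1_measurable theta)).
      - by move=> z; rewrite lee_fin loss_ge0.
    have mL : measurable_fun setT (fun tz : vec R n * vec R n =>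
        (loss s (delta (vadd tz.1 tz.2)) tz.1)%:E).
      apply/measurable_EFinP; pose v (tz : vec R n * vec R n) := (tz.1,
        vadd tz.1 tz.2).
      have mv : measurable_fun setT v.
        by apply/measurable_fun_pairP; split;
          [exact: measurable_fst|exact: measurable_vadd_pair].
      exact: (measurableT_comp (measurable_loss_pair s mdelta) mv).
    apply: (measurable_fun_fubini_tonelli_F _ mL) => tz.
    by rewrite lee_fin loss_ge0.
  - exact: measurable_cst.
  - by move=> theta _; apply: ereal_sup_ubound; exists theta.
case: S bound => [r|//|] bound; last by have := bound 1 ltr01; rewrite leeNy_eq.
  rewrite lee_fin leNgt; apply/negP => rn.
  have n0 : 0 < n%:R - r by rewrite subr_gt0.
  pose tau := 1 + `|n%:R * s ^+ 2| / (n%:R - r).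
  have K0 : 0 <= `|n%:R * s ^+ 2| / (n%:R - r) by rewrite divr_ge0// ltW.
  have tau1 : 1 <= tau by rewrite lerDl.
  have tau0 : 0 < tau by apply: lt_le_trans tau1.
  have := bound tau tau0; rewrite lee_fin mulrA ler_pdivrMr;
    last by rewrite addr_gt0 ?exprn_gt0.
  have : n%:R * s ^+ 2 <= (n%:R - r) * (tau - 1).
    rewrite (_ : _ * (tau - 1) = `|n%:R * s ^+ 2|) ?ler_norm//.
    by rewrite /tau; field; rewrite gt_eqF.
  have : tau <= tau ^+ 2 by rewrite expr2 ler_peMl// ltW.
  have := exprn_gt0 2 s0.
  nra.
by rewrite leey.
Qed.

End minimax_lower_bound.

(** * Power sums and the pointwise inequality *)

Section power_sums.
Context {R : realType}.

Lemma powRD_gt0 (x r s : R) : 0 < x -> x `^ (r + s) = x `^ r * x `^ s.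
Proof. by move=> x0; rewrite powRD// (gt_eqF x0) implybT. Qed.

Lemma powR_nonpos_le (x y e : R) : 0 < x -> x <= y -> e <= 0 ->
  y `^ e <= x `^ e.
Proof.
move=> x0 xy e0; have y0 : 0 < y by apply: lt_le_trans xy.
rewrite -[e]opprK (powRN y) (powRN x) lef_pV2 ?posrE ?powR_gt0//.
by rewrite ge0_ler_powR ?nnegrE ?oppr_ge0// ltW.
Qed.

Lemma continuous_powR_gt0 (e x : R) : 0 < x -> {for x,
  continuous (fun y : R => y `^ e)}.
Proof.
move=> x0; have H := is_derive1_powR e x0.
by apply: differentiable_continuous; apply/derivable1_diffP; case: H.
Qed.

Lemma is_derive_powR_comp (g : R -> R) (e x dg : R) : 0 < g x ->
  is_derive x 1 g dg ->
  is_derive x 1 (fun y => g y `^ e) (e * g x `^ (e - 1) * dg).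
Proof.
move=> gx dgx; have H := is_derive1_powR e gx.
exact: (is_derive1_comp H dgx).
Qed.

(** Chebyshev's sum inequality, by expanding the double sum. *)
Lemma chebyshev_sum_le n (a b : 'I_n -> R) :
  (forall i j, (a i - a j) * (b i - b j) <= 0) ->
  n%:R * (\sum_i a i * b i) <= (\sum_i a i) * (\sum_i b i).
Proof.
move=> ab.
have : \sum_i \sum_j (a i - a j) * (b i - b j) <= 0.
  by apply: sumr_le0 => i _; apply: sumr_le0 => j _; exact: ab.
rewrite (_ : \sum_i _ = 2 * (n%:R * (\sum_i a i * b i) - (\sum_i a i) * (\sum_i
  b i))).
  by rewrite pmulr_rle0// subr_le0.
have E i : \sum_j (a i - a j) * (b i - b j) =
    n%:R * (a i * b i) - a i * (\sum_j b j) - (\sum_j a j) * b i + \sum_j a j *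
      b j.
  transitivity (\sum_j (a i * b i - a i * b j - a j * b i + a j * b j)).
    by apply: eq_bigr => j _; ring.
  by rewrite !big_split/= !sumrN sumr_const card_ord -mulr_sumr -mulr_suml
    mulr_natl.
under eq_bigr do rewrite E.
rewrite !big_split/= !sumrN sumr_const card_ord -!mulr_suml -mulr_sumr.
rewrite -mulr_sumr -mulr_natl; ring.
Qed.

Lemma powR_anti_monotone (x y s t : R) : 0 < x -> 0 < y -> 0 <= s -> t <= 0 ->
  (x `^ s - y `^ s) * (x `^ t - y `^ t) <= 0.
Proof.
move=> + + s0 t0; wlog xy : x y / x <= y.
  move=> H x0 y0; have [/H|/ltW/H] := leP x y; first exact.
  by move=> /(_ y0 x0); rewrite -(opprB (x `^ s)) -(opprB (x `^ t)) mulrNN.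
move=> x0 y0; apply: mulr_le0_ge0.
  by rewrite subr_le0 ge0_ler_powR// ?nnegrE ltW.
by rewrite subr_ge0 powR_nonpos_le.
Qed.

(** With y = exp L, add the bounds exp u >= 1 + u at u = (1 - t) * L and at
   u = - t * L, weighted by t and 1 - t. *)
Lemma powR_le_tangent (y t : R) : 0 < y -> 0 <= t <= 1 ->
  y `^ t <= 1 + t * (y - 1).
Proof.
move=> y0 /andP[t0 t1]; rewrite /powR gt_eqF//; set L := ln y.
have -> : y = expR L by rewrite lnK.
have e1 := expR_gt0 (t * L).
have h1 : expR (t * L) * (1 + (1 - t) * L) <= expR L.
  rewrite (_ : expR L = expR (t * L) * expR ((1 - t) * L)); last first.
    by rewrite -expRD; congr expR; ring.
  by rewrite ler_pM2l// expR_ge1Dx.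
have h2 : expR (t * L) * (1 - t * L) <= 1.
  rewrite [leRHS](_ : 1 = expR (t * L) * expR (- (t * L))); last first.
    by rewrite -expRD subrr expR0.
  by rewrite ler_pM2l// expR_ge1Dx.
have := ler_wpM2l t0 h1; have t1' : 0 <= 1 - t by rewrite subr_ge0.
have := ler_wpM2l t1' h2; lra.
Qed.

Lemma power_sum_gt0 n (x : 'I_n -> R) (p : R) : (0 < n)%N ->
  (forall i, 0 < x i) -> 0 < \sum_i x i `^ p.
Proof.
case: n x => // n x _ x0; rewrite big_ord_recl ltr_wpDr ?powR_gt0//.
by apply: sumr_ge0 => i _; rewrite powR_ge0.
Qed.

(** At y = x i ^ p / T, with T the mean of these powers, the first-order terms
   of the tangent bound cancel in the sum. *)
Lemma power_mean_le n (x : 'I_n -> R) (p q : R) : (0 < n)%N ->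
  (forall i, 0 < x i) -> 0 < q -> q <= p ->
  \sum_i x i `^ q <= n%:R `^ (1 - q / p) * (\sum_i x i `^ p) `^ (q / p).
Proof.
move=> n0 x0 q0 qp; have p0 : 0 < p by apply: lt_le_trans qp.
have nR : 0 < n%:R :> R by rewrite ltr0n.
have Sp0 : 0 < \sum_i x i `^ p by exact: power_sum_gt0.
set S := \sum_i x i `^ p in Sp0 *; pose T := S / n%:R.
have T0 : 0 < T by rewrite divr_gt0.
have t01 : 0 <= q / p <= 1 by rewrite (ltW (divr_gt0 q0 p0)) ler_pdivrMr//
  mul1r.
have xq i : x i `^ q = (x i `^ p / T) `^ (q / p) * T `^ (q / p).
  rewrite -powRM ?divr_ge0 ?powR_ge0 ?ltW// divfK ?gt_eqF//.
  by rewrite -powRrM mulrCA divff ?mulr1// gt_eqF.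
have -> : n%:R `^ (1 - q / p) * S `^ (q / p) = n%:R * T `^ (q / p).
  rewrite /T powRM ?invr_ge0 ?ltW// powRB; last by apply/implyP => _;
    rewrite gt_eqF.
  rewrite powRr1 ?ltW// -(powR_inv1 (ltW nR)) -powRrM mulN1r powRN; ring.
under eq_bigr do rewrite xq.
rewrite -mulr_suml ler_wpM2r ?powR_ge0//.
apply: (@le_trans _ _ (\sum_i (1 + q / p * (x i `^ p / T - 1)))).
  by apply: ler_sum => i _; rewrite powR_le_tangent// divr_gt0 ?powR_gt0.
rewrite big_split/= -mulr_sumr sumrB -mulr_suml !sumr_const card_ord -/S.
by rewrite (_ : S / T = n%:R) ?subrr ?mulr0 ?addr0// /T; field; rewrite !gt_eqF.
Qed.

(** Chebyshev's inequality applies because x ^ p increases with x while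
   x ^ (- a) decreases. *)
Lemma negative_power_sum_ge n (x : 'I_n -> R) (p a : R) : (0 < n)%N ->
  (forall i, 0 < x i) -> 0 < p -> 0 <= a ->
  n%:R * ((\sum_i x i `^ (p - a)) / \sum_i x i `^ p) <= \sum_i x i `^ (- a).
Proof.
move=> n0 x0 p0 a0; have Sp0 : 0 < \sum_i x i `^ p by exact: power_sum_gt0.
rewrite mulrA ler_pdivrMr// [leRHS]mulrC.
under eq_bigr do rewrite powRD_gt0//.
by apply: chebyshev_sum_le => i j; rewrite powR_anti_monotone// ?oppr_le0// ltW.
Qed.

(** Where the minimum in the constant comes from. If p < 2 - a, no coordinate
   exceeds the norm r, so x ^ (2 - 2 * a) <= r ^ (2 - a - p) * x ^ (p - a), and
   the preceding lemma concludes with the factor 1. Otherwise Chebyshev's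
   inequality splits x ^ (2 - 2 * a) as x ^ (2 - a) * x ^ (- a), and the power
   mean inequality for 2 - a <= p costs a power of the dimension. *)
Lemma square_power_sum_le n (x : 'I_n -> R) (p a : R) : (0 < n)%N ->
  (forall i, 0 < x i) -> 0 < p -> 0 <= a < 1 ->
  n%:R * Num.min 1 (n%:R `^ ((2 - p - a) / p)) *
    ((\sum_i x i `^ p) `^ p^-1 `^ (a - 2) * \sum_i x i `^ (2 - 2 * a)) <=
  \sum_i x i `^ (- a).
Proof.
move=> n0 x0 p0 /andP[a0 a1]; have Sp0 : 0 < \sum_i x i `^ p by exact:
  power_sum_gt0.
set r := _ `^ p^-1; set m := Num.min _ _.
have r0 : 0 < r by rewrite powR_gt0.
have rp : r `^ p = \sum_i x i `^ p.
  by rewrite /r -powRrM mulVf ?gt_eqF// powRr1// ltW.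
have nR : 0 < n%:R :> R by rewrite ltr0n.
have [pa|pa] := leP (2 - a) p.
  have S1 : n%:R * (\sum_i x i `^ (2 - 2 * a)) <= (\sum_i x i `^ (2 - a)) *
    (\sum_i x i `^ (- a)).
    rewrite (eq_bigr (fun i => x i `^ (2 - a) * x i `^ (- a))); last first.
      move=> i _; rewrite -powRD_gt0//; congr (_ `^ _); ring.
    by apply: chebyshev_sum_le => i j; rewrite powR_anti_monotone ?oppr_le0//
      subr_ge0; lra.
  have S2 : \sum_i x i `^ (2 - a) <= n%:R `^ (- ((2 - p - a) / p)) * r `^ (2 -
    a).
    have := @power_mean_le n x p (2 - a) n0 x0 _ pa.
    rewrite /r -powRrM (_ : 1 - (2 - a) / p = - ((2 - p - a) / p));
      last by field; rewrite gt_eqF.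
    by rewrite (mulrC p^-1); apply; lra.
  set N := n%:R `^ (- ((2 - p - a) / p)) in S2.
  have mN : m * N <= 1.
    rewrite /N powRN -ler_pdivlMr ?invr_gt0 ?powR_gt0// invrK mul1r.
    by rewrite ge_min lexx orbT.
  have m0 : 0 <= m by rewrite le_min ler01 powR_ge0.
  have A0 : 0 <= \sum_i x i `^ (- a) by apply: sumr_ge0 => i _;
    rewrite powR_ge0.
  have ra : r `^ (a - 2) * r `^ (2 - a) = 1.
    by rewrite -powRD_gt0// (_ : a - 2 + (2 - a) = 0) ?powRr0//; ring.
  apply: (@le_trans _ _ (m * r `^ (a - 2) * (N * r `^ (2 - a) * \sum_i x i `^
    (- a)))); last first.
    rewrite (_ : m * _ * _ = m * N * (r `^ (a - 2) * r `^ (2 - a)) * (\sum_i x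
      i `^ (- a))); last by ring.
    by rewrite ra mulr1 ler_piMl.
  rewrite (_ : _ * _ * _ = m * r `^ (a - 2) * (n%:R * \sum_i x i `^ (2 - 2 *
    a))); last by ring.
  rewrite ler_wpM2l ?mulr_ge0 ?powR_ge0//.
  by apply: (le_trans S1); rewrite ler_wpM2r.
have xr i : x i <= r.
  have [xi r'] := (ltW (x0 i), ltW r0).
  suff : x i `^ p <= r `^ p.
    rewrite leNgt => H; rewrite leNgt; apply: contra H => rx.
    by rewrite gt0_ltr_powR// ?nnegrE.
  by rewrite rp (bigD1 i)//= lerDl sumr_ge0// => j _; rewrite powR_ge0.
have S1 : \sum_i x i `^ (2 - 2 * a) <= r `^ (2 - a - p) * \sum_i x i `^ (p - a).
  rewrite mulr_sumr; apply: ler_sum => i _.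
  rewrite (_ : 2 - 2 * a = (2 - a - p) + (p - a)); last by ring.
  rewrite (powRD_gt0 (2 - a - p) (p - a) (x0 i)) ler_wpM2r ?powR_ge0//
    ge0_ler_powR ?nnegrE//; [lra|exact: ltW|exact: ltW].
apply: (le_trans _ (negative_power_sum_ge n0 x0 p0 a0)).
rewrite -rp -mulrA ler_pM2l//.
have m1 : m <= 1 by rewrite ge_min lexx.
have B0 : 0 <= r `^ (a - 2) * \sum_i x i `^ (2 - 2 * a).
  by rewrite mulr_ge0 ?powR_ge0// sumr_ge0// => i _; rewrite powR_ge0.
apply: (le_trans (ler_piMl B0 m1)).
apply: (le_trans (ler_wpM2l (powR_ge0 _ _) S1)).
rewrite mulrA -powRD_gt0// (_ : a - 2 + _ = - p); last by ring.
by rewrite powRN mulrC.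
Qed.

(** At a point of p-norm r, a lower bound for the derivative of
   psi r * r ^ (a - 2) * |z_i| ^ (- a) * z_i with respect to the coordinate z_i,
   where x = |z_i|: the derivative of the profile psi at r has been replaced by
   - k * psi * (c - psi) / (c * r). *)
Definition drift (p a k c : R) (psi r x : R) : R :=
  psi * r `^ (a - 2) * x `^ (- a) *
    (1 - a - (2 - a + k * (1 - psi / c)) * (x `^ p / r `^ p)).

(** The inequality that makes the unbiased estimate of the excess risk
   nonpositive. After division by psi * r ^ (a - 2) both sides are affine in
   psi, and the two comparisons of power sums settle all of [0, c]. *)
Lemma drift_ge n (x : 'I_n -> R) (p a psi : R) (r := (\sum_i x i `^ p) `^ p^-1)
    (k := n%:R - 2 - a * (n%:R - 1))
    (c := 2 * k * Num.min 1 (n%:R `^ ((2 - p - a) / p))) :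
  (0 < n)%N -> (forall i, 0 < x i) -> 0 < p -> 0 <= a < 1 -> 0 < k ->
  0 <= psi <= c ->
  \sum_i (psi * r `^ (a - 2) * x i `^ (1 - a)) ^+ 2 <=
  2 * \sum_i drift p a k c psi r (x i).
Proof.
move=> n0 x0 p0 a01 k0 /andP[psi0 psic].
have [a0 a1] := andP a01.
have nR : 0 < n%:R :> R by rewrite ltr0n.
have := square_power_sum_le n0 x0 p0 a01; have :=
  negative_power_sum_ge n0 x0 p0 a0.
have Sp0 : 0 < \sum_i x i `^ p by exact: power_sum_gt0.
have r0 : 0 < r by rewrite powR_gt0.
have rp : r `^ p = \sum_i x i `^ p.
  by rewrite /r -powRrM mulVf ?gt_eqF// powRr1// ltW.
rewrite -/r -rp.
set A := \sum_i x i `^ (- a); set B0 := \sum_i x i `^ (p - a).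
set D0 := \sum_i x i `^ (2 - 2 * a); set m := Num.min _ _ in c psic *.
move=> BA DA.
have m0 : 0 < m by rewrite lt_min ltr01 powR_gt0.
have c0 : 0 < c by rewrite !mulr_gt0.
have -> : \sum_i (psi * r `^ (a - 2) * x i `^ (1 - a)) ^+ 2 = (psi * r `^ (a -
  2)) ^+ 2 * D0.
  rewrite mulr_sumr; apply: eq_bigr => i _; rewrite exprMn; congr (_ * _).
  by rewrite -powR_mulrn ?powR_ge0// -powRrM; congr (_ `^ _); ring.
have -> : \sum_i drift p a k c psi r (x i) =
    psi * r `^ (a - 2) * ((1 - a) * A - (2 - a + k * (1 - psi / c)) * (B0 / r
      `^ p)).
  rewrite mulrBr !mulr_sumr mulr_suml !mulr_sumr -sumrB; apply: eq_bigr => i _.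
  rewrite /drift (powRD_gt0 p (- a) (x0 i)); ring.
have pr0 : 0 <= psi * r `^ (a - 2) by rewrite mulr_ge0 ?powR_ge0.
rewrite expr2 -mulrA [leRHS]mulrCA ler_wpM2l//.
pose t := psi / c; have psit : psi = t * c by rewrite divfK ?gt_eqF.
have t1 : t <= 1 by rewrite ler_pdivrMr ?mul1r.
have t0 : 0 <= t by rewrite divr_ge0// ltW.
rewrite -/t (_ : psi = t * (2 * k * m))// -(ler_pM2l nR).
set D := n%:R * m * (r `^ (a - 2) * D0) in DA; set B :=
  n%:R * (B0 / r `^ p) in BA.
rewrite (_ : n%:R * (t * (2 * k * m) * r `^ (a - 2) * D0) = 2 * k * t * D);
  last by rewrite /D; ring.
rewrite (_ : n%:R * _ = 2 * (n%:R * (1 - a) * A - (2 - a + k * (1 - t)) * B));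
  last by rewrite /B; ring.
have -> : 2 - a + k * (1 - t) = n%:R * (1 - a) - k * t by rewrite /k; ring.
(* what remains is k t D <= n (1 - a) (A - B) + k t B; here D <= A, B <= A and
   k t <= n (1 - a) *)
have H1 : k * t * D <= k * t * A by rewrite ler_wpM2l// mulr_ge0// ltW.
have H2 : 0 <= (n%:R * (1 - a) - k * t) * (A - B).
  rewrite mulr_ge0// ?subr_ge0//.
  apply: (@le_trans _ _ k); first by rewrite ler_piMr// ltW.
  by rewrite /k; nra.
lra.
Qed.

End power_sums.

(** * Stein's inequality on the line *)

Section stein_inequality.
Context {R : realType}.
Notation mu := (@lebesgue_measure R).

Variables (s : R) (G h : R -> R) (M : R).
Hypothesis s0 : 0 < s.
Hypothesis mG : measurable_fun setT G.
Hypothesis cG : forall x : R, 0 < x -> {for x, continuous G}.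
Hypothesis ch : forall x : R, 0 < x -> {for x, continuous h}.
Hypothesis slope : forall x : R, 0 < x -> exists E : R -> R,
  [/\ E x = G x, forall y : R, x <= y -> E y <= G y & is_derive x 1 E (h x)].
Hypothesis GM : forall x, `|G x| <= M.
Hypothesis G0 : G x @[x --> 0^'+] --> 0.
Hypothesis odd_G : forall x, G (- x) = - G x.
Hypothesis even_h : forall x, h (- x) = h x.
Hypothesis inth : forall m, (normal_prob m s).-integrable setT (EFin \o h).

Let F m x := s ^+ 2 * h x - (x - m) * G x.

Let intxG m : (normal_prob m s).-integrable setT (fun x : measurableTypeR R =>
  ((x - m) * G x)%:E).
Proof.
have mxG : measurable_fun setT (fun x : measurableTypeR R => ((x - m) * G
  x)%:E).
  by apply/measurable_EFinP/measurable_funM => //; exact: measurable_funB.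
have i1 : (normal_prob m s).-integrable setT (fun x : measurableTypeR R => ((x
  - m) ^+ 2)%:E).
  apply/integrableP; split.
    by apply/measurable_EFinP/measurable_funX; exact: measurable_funB.
  under eq_integral do rewrite gee0_abs ?lee_fin ?sqr_ge0//.
  by rewrite normal_variance// ltry.
have i2 : (normal_prob m s).-integrable setT (cst 1%E).
  by apply: finite_measure_integrable_cst.
have i3 := integrableZl measurableT M (integrableD measurableT i1 i2).
apply: (le_integrable measurableT mxG _ i3) => x _.
have M0 : 0 <= M by apply: le_trans (GM 0).
rewrite /= lee_fin normrM [leRHS]ger0_norm ?mulr_ge0 ?addr_ge0 ?sqr_ge0//.
rewrite mulrC ler_pM//.
have E : `|x - m| ^+ 2 = (x - m) ^+ 2 by rewrite real_normK ?num_real.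
have := sqr_ge0 (`|x - m| - 1); have := sqr_ge0 `|x - m|; nra.
Qed.

Let intF m : (normal_prob m s).-integrable setT (EFin \o F m).
Proof.
have := integrableB measurableT (integrableZl measurableT (s ^+ 2) (inth m))
  (intxG m).
by [].
Qed.

Let half_line m :
  (\int[mu]_(x in `]0%R, +oo[) (F m x * normal_pdf m s x)%:E <= 0)%E.
Proof.
have sn : s != 0 by rewrite gt_eqF.
have cn (y : R) : {for y, continuous (normal_pdf m s)} by exact:
  continuous_normal_pdf.
apply: (@integral_le0_of_minorants R (fun x => s ^+ 2 * (G x * normal_pdf m s
  x))).
- by move=> x x0; apply: cvgM; [exact: cvg_cst|apply: cvgM;
  [exact: cG|exact: cn]].
- move=> x x0; apply: cvgM; last exact: cn.
  apply: cvgB; first by apply: cvgM; [exact: cvg_cst|exact: ch].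
  by apply: cvgM; [apply: cvgB; [exact: cvg_id|exact: cvg_cst]|exact: cG].
- move=> x x0; have [E [Ex EG dE]] := slope x0.
  exists (fun x => s ^+ 2 * (E x * normal_pdf m s x)); split.
  + by rewrite Ex.
  + by move=> y xy; rewrite ler_wpM2l ?sqr_ge0// ler_wpM2r ?normal_pdf_ge0// EG.
  + have dn := is_derive_normal_pdf m x sn.
    apply: is_derive_eq; rewrite /GRing.scale/= Ex /F.
    by field.
- exact: (integrable_normal_prob (measurable_itv _) (integrableS _ _ _ (intF
  m))).
- rewrite -[X in _ --> X](mulr0 (s ^+ 2)); apply: cvgM; first exact: cvg_cst.
  rewrite -[X in _ --> X](mul0r (normal_pdf m s 0)); apply: cvgM;
    first exact: G0.
  by apply: cvg_at_right_filter; exact: cn.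
- rewrite -[X in _ --> X](mulr0 (s ^+ 2)); apply: cvgM; first exact: cvg_cst.
  have H : M * normal_pdf m s x @[x --> +oo] --> 0.
    rewrite -[X in _ --> X](mulr0 M); apply: cvgM; first exact: cvg_cst.
    exact: cvg_normal_pdf.
  have HN : - (M * normal_pdf m s x) @[x --> +oo] --> 0.
    by rewrite -[X in _ --> X]oppr0; exact: cvgN.
  apply: (squeeze_cvgr _ HN H).
  near=> x; have := GM x; rewrite ler_norml => /andP[GM1 GM2].
  apply/andP; split; last by rewrite ler_wpM2r ?normal_pdf_ge0.
  by rewrite -mulNr ler_wpM2r ?normal_pdf_ge0.
Unshelve. all: by end_near.
Qed.

(** One half of Stein's identity: s^2 E[h X] <= E[(X - m) G X] when h bounds the
   slope of G from below. On the positive half line, multiply G by the density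
   and integrate the slope of the product; the negative half line is the
   positive one of the problem reflected about 0. *)
Lemma normal_stein_le m :
  (\int[normal_prob m s]_x (s ^+ 2 * h x - (x - m) * G x)%:E <= 0)%E.
Proof.
have sn : s != 0 by rewrite gt_eqF.
have mF k D : measurable_fun D (F k).
  by apply: measurable_funTS; have /measurable_EFinP :=
    measurable_int _ (intF k).
have half k : (\int[normal_prob k s]_(x in `]0%R, +oo[) (F k x)%:E <= 0)%E.
  by rewrite integral_normal_prob; [exact: half_line|exact:
    measurable_itv|exact: mF].
rewrite (_ : [set: measurableTypeR R] = `]-oo, 0] `|` `]0, +oo[); last first.
  by apply/seteqP; split => // x _ /=; rewrite !in_itv/= andbT;
    case: (leP x 0); [left|right].
rewrite integral_setU_EFin; first last.
- by apply/disj_setPS => x [] /=; rewrite !in_itv/= andbT => x1 /lt_le_trans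
  /(_ x1); rewrite ltxx.
- exact: mF.
- exact: measurable_itv.
- exact: measurable_itv.
rewrite -[leRHS]adde0; apply: leeD; last exact: half.
(* on ]-oo, 0], the law of - X is normal with mean - m *)
rewrite (eq_measure_integral (pushforward (normal_prob (- m) s) opp_line));
  last first.
  by move=> B mB _; have := normal_probN (- m) sn mB; rewrite opprK.
have oppF x : F m (opp_line x) = F (- m) x.
  by rewrite /F /opp_line odd_G even_h; ring.
have intf' : (normal_prob (- m) s).-integrable setT ((EFin \o F m) \o opp_line).
  rewrite (_ : (EFin \o F m) \o opp_line = EFin \o F (- m)); first exact: intF.
  by apply/funext => x /=; rewrite oppF.
rewrite integral_pushforward; first last.
- exact: measurable_itv.
- apply: (integrableS measurableT _ (@subsetT _ _) intf').
  by rewrite -[X in measurable X]setTI; apply: measurable_opp_line => //;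
    exact: measurable_itv.
- exact: (measurable_int _ (intF m)).
- exact: measurable_opp_line.
rewrite (_ : _ @^-1` _ = `[0, +oo[%classic); last first.
  by apply/seteqP; split => x /=; rewrite !in_itv/= /opp_line ?andbT ?oppr_le0.
rewrite (_ : (\int[_]_(x in _) _ = \int[normal_prob (- m) s]_(x in `[0%R,
  +oo[) (F (- m) x)%:E)%E); last first.
  by apply: eq_integral => x _ /=; rewrite -oppF.
rewrite integral_normal_prob; [|exact: measurable_itv|exact: mF].
rewrite -integral_itv_obnd_cbnd; first exact: half_line.
apply/measurable_EFinP/measurable_funM; first exact: mF.
by apply: measurable_funTS; exact: measurable_normal_pdf.
Qed.

End stein_inequality.

(** * Integrability of negative powers *)

Section inverse_power.
Context {R : realType}.
Notation mu := (@lebesgue_measure R).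

(** On each [1 / (n + 2), 1] the primitive gives at most 1 / (1 - e). *)
Lemma integral_powRN_unit (e : R) : 0 <= e -> e < 1 ->
  (\int[mu]_(x in `]0%R, 1%R]) (x `^ (- e))%:E < +oo)%E.
Proof.
move=> e0 e1; have e1' : 0 < 1 - e by rewrite subr_gt0.
pose I (n : nat) : set R := `[n.+2%:R^-1, 1]%classic.
have I0 n x : I n x -> 0 < x.
  by rewrite /I /= in_itv/= => /andP[+ _]; apply: lt_le_trans; rewrite invr_gt0.
pose F (x : R) := (1 - e)^-1 * x `^ (1 - e).
have dF (x : R) : 0 < x -> is_derive x 1 F (x `^ (- e)).
  move=> x0; have H := is_derive1_powR (1 - e) x0.
  apply: is_derive_eq; rewrite /GRing.scale/= (_ : 1 - e - 1 = - e);
    last by ring.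
  by field; rewrite gt_eqF.
have cp (x : R) : 0 < x -> {for x, continuous (fun y : R => y `^ (- e))}.
  move=> x0; have H := is_derive1_powR (- e) x0.
  by apply: differentiable_continuous; apply/derivable1_diffP; case: H.
have bound n : (\int[mu]_(x in I n) (x `^ (- e))%:E <= ((1 - e)^-1)%:E)%E.
  have an0 : 0 < n.+2%:R^-1 :> R by rewrite invr_gt0.
  have ab : n.+2%:R^-1 < 1 :> R by rewrite invf_lt1 ?ltr1n.
  rewrite (@continuous_FTC2 R _ F _ _ ab).
  - rewrite -EFinB lee_fin /F powR1 mulr1 gerBl mulr_ge0 ?powR_ge0// invr_ge0
    ltW//.
  - apply: continuous_in_subspaceT => x; rewrite inE => /I0; exact: cp.
  - split.
    + move=> x; rewrite in_itv/= => /andP[x1 _].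
      have x0 : 0 < x by apply: lt_trans x1; rewrite invr_gt0.
      by have [] := dF _ x0.
    + apply: cvg_at_right_filter; apply: differentiable_continuous;
      apply/derivable1_diffP.
      by have [] := dF _ an0.
    + apply: cvg_at_left_filter; apply: differentiable_continuous;
      apply/derivable1_diffP.
      by have [] := dF 1 ltr01.
  - move=> x; rewrite in_itv/= => /andP[x1 _].
    have x0 : 0 < x by apply: lt_trans x1; rewrite invr_gt0.
    by have [_ H] := dF _ x0; rewrite derive1E.
rewrite (_ : `]0, 1]%classic = \bigcup_n I n); last first.
  apply/seteqP; split => x.
    rewrite /= in_itv/= => /andP[x0 x1].
    have [n /ltW xn] : exists n : nat, x^-1 < n%:R.
      by exists (Num.trunc x^-1).+1; rewrite truncnS_gt.
    exists n => //; rewrite /I /= in_itv/= x1 andbT.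
    by rewrite invf_ple ?posrE//; apply: (le_trans xn);
      rewrite ler_nat -addn2 leq_addr.
  move=> [n _ In]; have x0 := I0 _ _ In; move: In; rewrite /I /= !in_itv/=.
  by rewrite x0 => /andP[].
apply: (@le_lt_trans _ _ ((1 - e)^-1)%:E); last exact: ltry.
have cv : (\int[mu]_(x in I n) (x `^ (- e))%:E @[n --> \oo] -->
    \int[mu]_(x in \bigcup_n I n) (x `^ (- e))%:E)%E.
  apply: ge0_nondecreasing_set_cvg_integral.
- move=> n m nm; apply/subsetPset => x; rewrite /I /= !in_itv/= => /andP[x1
  ->]; rewrite andbT.
  by apply: le_trans x1; rewrite lef_pV2 ?posrE// ler_nat !ltnS.
- by move=> n; exact: measurable_itv.
- by move=> n; apply/measurable_EFinP; apply: measurable_funTS;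
  exact: measurable_powR.
- by move=> n x _; rewrite lee_fin powR_ge0.
by apply: (cvge_to_le cv); apply: nearW => n; exact: bound.
Qed.

(** The density is bounded, which settles ]-1, 1[; elsewhere the power is at
   most 1. *)
Lemma integrable_normal_powRN (m s e : R) : s != 0 -> 0 <= e -> e < 1 ->
  (normal_prob m s).-integrable setT (fun x => (`|x| `^ (- e))%:E).
Proof.
move=> s0 e0 e1.
pose q (x : measurableTypeR R) : \bar R := ((fun x => (x `^ (- e))%:E) \_
  `]0%R, 1%R]) x.
have mpow : measurable_fun setT (fun x : R => x `^ (- e)) by exact:
  measurable_powR.
have q0 x : (0 <= q x)%E.
  by rewrite /q patchE; case: ifP => // _; rewrite lee_fin powR_ge0.
have mq : measurable_fun setT q.
  apply/(measurable_restrictT _ (measurable_itv _)).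
  by apply: measurable_funTS; exact/measurable_EFinP.
have iq k : (\int[normal_prob k s]_x q x < +oo)%E.
  rewrite ge0_integral_normal_prob; [|exact: measurableT|exact: mq|exact: q0].
  apply: (@le_lt_trans _ _ (\int[mu]_x (q x * (normal_peak s)%:E))%E).
    apply: ge0_le_integral.
    - exact: measurableT.
    - by move=> x _; rewrite mule_ge0// lee_fin normal_pdf_ge0.
    - apply: emeasurable_funM => //; apply/measurable_EFinP;
      exact: measurable_normal_pdf.
    - by apply: emeasurable_funM => //; exact: measurable_cst.
    - by move=> x _; rewrite lee_wpmul2l// lee_fin normal_pdf_ub.
  rewrite ge0_integralZr//; last by rewrite lee_fin normal_peak_ge0.
  rewrite muleC lte_mul_pinfty ?lee_fin ?normal_peak_ge0//.
  rewrite /q -integral_mkcond; exact: integral_powRN_unit.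
have bnd (x : R) : ((`|x| `^ (- e))%:E <= 1 + (q x + q (- x)%R))%E.
  have p1 y : 1 <= y -> y `^ (- e) <= 1.
    move=> y1; rewrite powRN invf_le1 ?powR_gt0 ?(lt_le_trans _ y1)//.
    by rewrite -(powRr0 y) ler_powR.
  have [->|xn0] := eqVneq x 0.
    rewrite normr0 (@le_trans _ _ 1%E) ?leeDl ?adde_ge0// lee_fin.
    by rewrite /powR eqxx; case: eqP.
  have [x1|/ltW x1] := leP `|x| 1; last first.
    by rewrite (@le_trans _ _ 1%E) ?leeDl ?adde_ge0// lee_fin p1.
  apply: (@le_trans _ _ (q x + q (- x)%R)%E); last by rewrite leeDr.
  have [x0|x0] := ltP 0 x.
    apply: (@le_trans _ _ (q x)); last by rewrite leeDl.
    rewrite gtr0_norm// /q patchE mem_set//= in_itv/= x0.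
    by move: x1; rewrite gtr0_norm.
  have x0' : x < 0 by rewrite lt_neqAle xn0.
  apply: (@le_trans _ _ (q (- x)%R)); last by rewrite leeDr.
  rewrite ltr0_norm// /q patchE mem_set//= in_itv/= oppr_gt0 x0'.
  by move: x1; rewrite ltr0_norm.
have mqN : measurable_fun setT (fun x : measurableTypeR R => q (- x)%R).
  exact: (measurableT_comp mq measurable_opp_line).
have mx : measurable_fun setT (fun x : measurableTypeR R => (`|x| `^ (- e))%:E).
  by apply/measurable_EFinP; apply: (measurableT_comp mpow);
    exact: normr_measurable.
apply/integrableP; split; first exact: mx.
apply: (@le_lt_trans _ _ (\int[normal_prob m s]_x (cst 1 x + (q x + q (-
  x)%R)))%E).
  apply: ge0_le_integral.
  - exact: measurableT.
  - by move=> x _; exact: abse_ge0.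
  - exact: (measurableT_comp _ mx).
  - by apply: emeasurable_funD; [exact: measurable_cst|exact: emeasurable_funD].
  - by move=> x _; rewrite gee0_abs ?lee_fin ?powR_ge0//; exact: bnd.
rewrite ge0_integralD; [|exact: measurableT|by []|exact: measurable_cst|
  by move=> x _; rewrite adde_ge0|exact: emeasurable_funD].
rewrite ge0_integralD; [|exact: measurableT|by []|exact: mq|by []|exact: mqN].
apply: lte_add_pinfty.
  by rewrite integral_cst ?mul1e; [rewrite (le_lt_trans (probability_le1 _ _))
    ?ltry|].
apply: lte_add_pinfty; first exact: iq.
by rewrite -(ge0_integral_normalN m s0 mq q0); exact: iq.
Qed.

End inverse_power.

(** * The correction along a coordinate line *)

Section coordinate_line.
Context {R : realType}.
Variables (p a k c : R) (psi : R -> R).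
Hypothesis p0 : 0 < p.
Hypothesis a0 : 0 <= a.
Hypothesis a1 : a < 1.
Hypothesis k0 : 0 < k.
Hypothesis c0 : 0 < c.
Hypothesis psi_bound : forall v : R, 0 <= v -> 0 <= psi v <= c.
Hypothesis psi_cont : continuous psi.
Hypothesis psi_cross : forall v w : R, 0 < v -> v <= w ->
  psi v * (c - psi w) * v `^ k <= psi w * (c - psi v) * w `^ k.

(** The estimator is z - s^2 g with g_i = correction r z_i, where r is the
   p-norm of z. *)
Definition correction (r x : R) : R := psi r * r `^ (a - 2) * `|x| `^ (- a) * x.

(** The p-norm as a function of one coordinate x; b is the sum of the p-th
   powers of the absolute values of the other ones. *)
Definition line_norm (b x : R) : R := (`|x| `^ p + b) `^ p^-1.

(** Among the profiles taking the value psi v0 at v0, the one for which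
   v ^ k * psi v / (c - psi v) is constant: monotonicity of that quotient puts
   psi above it to the right of v0. *)
Let profile_floor (v0 w : R) := c * psi v0 * v0 `^ k / ((c - psi v0) * w `^ k +
  psi v0 * v0 `^ k).

Let profile_floor_den_gt0 (v0 w : R) : 0 < v0 -> 0 < w ->
  0 < (c - psi v0) * w `^ k + psi v0 * v0 `^ k.
Proof.
move=> v00 w0; have /andP[ps0 psc] := psi_bound (ltW v00).
have [psn|ps1] := eqVneq (psi v0) 0.
  by rewrite psn subr0 mul0r addr0 mulr_gt0 ?powR_gt0.
apply: ltr_wpDl; first by rewrite mulr_ge0 ?powR_ge0// subr_ge0.
by rewrite mulr_gt0 ?powR_gt0// lt_neqAle eq_sym ps1.
Qed.

Let profile_floor_le (v0 w : R) : 0 < v0 -> v0 <= w ->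
  profile_floor v0 w <= psi w.
Proof.
move=> v00 vw; have w0 : 0 < w by apply: lt_le_trans vw.
rewrite /profile_floor ler_pdivrMr ?profile_floor_den_gt0//.
have := psi_cross v00 vw; lra.
Qed.

Let profile_floor_base (v0 : R) : 0 < v0 -> profile_floor v0 v0 = psi v0.
Proof.
move=> v00; have v0k : 0 < v0 `^ k by rewrite powR_gt0.
by rewrite /profile_floor; field; rewrite !gt_eqF// -mulrDl subrK mulr_gt0.
Qed.

Lemma line_norm_gt0 (b x : R) : 0 < b -> 0 < line_norm b x.
Proof. by move=> b0; rewrite powR_gt0// ltr_wpDl ?powR_ge0. Qed.

Lemma le_line_norm (b x y : R) : 0 <= b -> `|x| <= `|y| ->
  line_norm b x <= line_norm b y.
Proof.
move=> b0 xy; rewrite ge0_ler_powR ?nnegrE ?addr_ge0 ?powR_ge0 ?invr_ge0 ?(ltW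
  p0)//.
by rewrite lerD2r ge0_ler_powR ?nnegrE// ltW.
Qed.

(** Putting the floor through the current point in place of psi gives a smooth
   minorant. Its derivative comes from r' = r * (x ^ p / r ^ p) / x and from the
   slope - k * psi * (c - psi) / (c * r) of the floor at r. *)
Lemma correction_slope (b x : R) : 0 < b -> 0 < x ->
  exists E : R -> R,
  [/\ E x = correction (line_norm b x) x,
      forall y : R, x <= y -> E y <= correction (line_norm b y) y
    & is_derive x 1 E (drift p a k c (psi (line_norm b x)) (line_norm b x)
      `|x|)].
Proof.
move=> b0 x0.
pose U y := y `^ p + b.
pose r y := U y `^ p^-1.
have rE (y : R) : 0 < y -> line_norm b y = r y by move=> y0;
  rewrite /line_norm gtr0_norm.
have r0 (y : R) : 0 < y -> 0 < r y by move=> y0; rewrite -rE// line_norm_gt0.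
pose E y := profile_floor (r x) (r y) * (r y `^ (a - 2) * y `^ (1 - a)).
have corrE (y : R) : 0 < y -> correction (r y) y = psi (r y) * (r y `^ (a - 2)
  * y `^ (1 - a)).
  move=> y0; rewrite /correction gtr0_norm// (addrC 1) (powRD_gt0 (- a) 1 y0)
    powRr1 ?ltW//.
  ring.
have ln (y : R) : x <= y -> r x <= r y.
  move=> xy; have y0 : 0 < y by apply: lt_le_trans xy.
  rewrite -(rE _ x0) -(rE _ y0); apply: le_line_norm; first exact: ltW.
  by rewrite !gtr0_norm.
exists E; split.
- by rewrite rE// corrE// /E profile_floor_base// r0.
- move=> y xy; have y0 : 0 < y by apply: lt_le_trans xy.
  rewrite rE// corrE// /E ler_wpM2r ?mulr_ge0 ?powR_ge0//.
  by apply: profile_floor_le; [exact: r0|exact: ln].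
rewrite (rE _ x0) (gtr0_norm x0).
have rx0 := r0 x x0; set rx := r x in rx0 *.
have Ux0 : 0 < U x by rewrite ltr_wpDl ?powR_ge0.
have dU : is_derive x 1 U (p * x `^ (p - 1)).
  have H := is_derive1_powR p x0.
  by apply: is_derive_eq; rewrite addr0.
have dr : is_derive x 1 r (rx * (x `^ p / rx `^ p) / x).
  have H := is_derive_powR_comp p^-1 Ux0 dU.
  apply: (is_derive_eq H).
  have Urx : U x = rx `^ p by rewrite /rx /r -powRrM mulVf ?gt_eqF// powRr1//
    ltW.
  have xp : x `^ (p - 1) = x `^ p / x by rewrite powRD_gt0// powR_inv1// ltW.
  have up : U x `^ (p^-1 - 1) = rx / rx `^ p.
    by rewrite powRD_gt0// -/(r x) -/rx powR_inv1 ?Urx// powR_ge0.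
  by rewrite xp up; field; rewrite !gt_eqF ?powR_gt0.
have drk : is_derive x 1 (fun y => r y `^ k) (k * rx `^ (k - 1) * (rx * (x `^ p
  / rx `^ p) / x)).
  exact: is_derive_powR_comp.
have dra : is_derive x 1 (fun y => r y `^ (a - 2)) ((a - 2) * rx `^ (a - 2 - 1)
  * (rx * (x `^ p / rx `^ p) / x)).
  exact: is_derive_powR_comp.
have dx := is_derive1_powR (1 - a) x0.
have den0 : (c - psi rx) * r x `^ k + psi rx * rx `^ k != 0 by rewrite gt_eqF//
  profile_floor_den_gt0.
have dden : is_derive x 1 (fun y => (c - psi rx) * r y `^ k + psi rx * rx `^ k)
  ((c - psi rx) * (k * rx `^ (k - 1) * (rx * (x `^ p / rx `^ p) / x))).
  apply: is_derive_eq; rewrite /GRing.scale/= addr0; ring.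
have dinv := @is_deriveV R (fun y => (c - psi rx) * r y `^ k + psi rx * rx `^
  k) x _ _ den0 dden.
have v0k : 0 < rx `^ k by rewrite powR_gt0.
have xn : x != 0 by rewrite gt_eqF.
have rn : rx != 0 by rewrite gt_eqF.
have rkn : rx `^ k != 0 by rewrite gt_eqF.
have cn : c != 0 by rewrite gt_eqF.
have rpn : rx `^ p != 0 by rewrite gt_eqF// powR_gt0.
have rk1 : rx `^ (k - 1) = rx `^ k / rx by rewrite powRD_gt0// powR_inv1// ltW.
have ra1 : rx `^ (a - 2 - 1) = rx `^ (a - 2) / rx by rewrite (powRD_gt0 (a -
  2))// powR_inv1// ltW.
have xa1 : x `^ (1 - a - 1) = x `^ (- a) by congr (_ `^ _); ring.
have xa : x `^ (1 - a) = x `^ (- a) * x.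
  by rewrite (addrC 1) (powRD_gt0 (- a) 1 x0) powRr1// ltW.
rewrite /E /profile_floor; apply: is_derive_eq.
rewrite /GRing.scale/= -/rx /drift rk1 ra1 xa1 xa.
rewrite (_ : (c - psi rx) * rx `^ k + psi rx * rx `^ k = c * rx `^ k);
  last by ring.
field.
by rewrite ?xn ?rn ?rkn ?cn ?rpn.
Qed.

Lemma correction_bound (r x : R) : 0 < r -> `|x| <= r ->
  `|correction r x| <= c / r.
Proof.
move=> r0 xr; have /andP[ps0 psc] := psi_bound (ltW r0).
have [->|xn] := eqVneq x 0; first by rewrite /correction mulr0 normr0
  divr_ge0// ltW.
have x0 : 0 < `|x| by rewrite normr_gt0.
rewrite /correction normrM ger0_norm ?mulr_ge0 ?powR_ge0// -!mulrA.
apply: ler_pM => //; first by rewrite !mulr_ge0 ?powR_ge0.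
have -> : `|x| `^ (- a) * `|x| = `|x| `^ (1 - a).
  by rewrite (addrC 1) (powRD_gt0 (- a) 1 x0) powRr1// ltW.
have -> : r^-1 = r `^ (a - 2) * r `^ (1 - a).
  rewrite -(powRD_gt0 _ _ r0) (_ : a - 2 + (1 - a) = - 1); last by ring.
  by rewrite powR_inv1// ltW.
rewrite ler_wpM2l ?powR_ge0// ge0_ler_powR ?nnegrE// ?subr_ge0; exact: ltW.
Qed.

Lemma drift_bound (r x : R) : 0 < r -> 0 <= x -> x <= r ->
  `|drift p a k c (psi r) r x| <= c * (3 - 2 * a + k) * (r `^ (a - 2) * x `^ (-
    a)).
Proof.
move=> r0 x0 xr; have /andP[ps0 psc] := psi_bound (ltW r0).
rewrite /drift normrM ger0_norm ?mulr_ge0 ?powR_ge0//.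
set q := x `^ p / _; set t := psi r / c.
have q0 : 0 <= q by rewrite divr_ge0 ?powR_ge0.
have q1 : q <= 1.
  by rewrite /q ler_pdivrMr ?powR_gt0// mul1r ge0_ler_powR ?nnegrE// ltW.
have t0 : 0 <= t by rewrite divr_ge0// ltW.
have t1 : t <= 1 by rewrite ler_pdivrMr ?mul1r.
set b := 2 - a + k * (1 - t).
have b0 : 0 <= b.
  have : 0 <= k * (1 - t) by rewrite mulr_ge0 ?(ltW k0)// subr_ge0.
  by have := a1; rewrite /b; lra.
have b1 : b <= 2 - a + k by rewrite lerD2l ler_piMr ?(ltW k0)// gerBl.
have bq0 : 0 <= b * q by rewrite mulr_ge0.
have bq : b * q <= 2 - a + k by apply: (le_trans _ b1); rewrite ler_piMr.
have H : `|1 - a - b * q| <= 3 - 2 * a + k.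
  rewrite ler_norml; apply/andP; split; have := k0; have := a1; lra.
have X0 : 0 <= r `^ (a - 2) * x `^ (- a) by rewrite mulr_ge0 ?powR_ge0.
rewrite (_ : c * _ * _ = (c * (r `^ (a - 2) * x `^ (- a))) * (3 - 2 * a + k));
  last by ring.
apply: ler_pM => //; first by rewrite !mulr_ge0 ?powR_ge0.
by rewrite -mulrA ler_wpM2r.
Qed.

Lemma continuous_line_norm (b x : R) : 0 < b -> 0 < x ->
  {for x, continuous (line_norm b)}.
Proof.
move=> b0 x0; have xn : 0 < `|x| by rewrite gtr0_norm.
have c1 : (fun y : R => `|y| `^ p + b) @ x --> `|x| `^ p + b.
  apply: cvgD; last exact: cvg_cst.
  apply: (@cvg_comp _ _ _ (fun y : R => `|y|) (fun y : R => y `^ p) (nbhs x)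
    (nbhs `|x|)); first exact: norm_continuous.
  exact: continuous_powR_gt0.
apply: (@cvg_comp _ _ _ (fun y : R => `|y| `^ p + b) (fun y : R => y `^ p^-1)
  (nbhs x) (nbhs (`|x| `^ p + b))); first exact: c1.
apply: continuous_powR_gt0.
by rewrite ltr_wpDl ?powR_ge0.
Qed.

Lemma norm_le_line_norm (b x : R) : 0 <= b -> `|x| <= line_norm b x.
Proof.
move=> b0; rewrite -[leLHS]powRr1// -[X in _ `^ X](mulfV (lt0r_neq0 p0)) powRrM.
by rewrite ge0_ler_powR ?nnegrE ?addr_ge0 ?powR_ge0 ?invr_ge0 ?(ltW p0)// lerDl.
Qed.

Lemma root_le_line_norm (b x : R) : 0 <= b -> b `^ p^-1 <= line_norm b x.
Proof.
move=> b0.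
by rewrite ge0_ler_powR ?nnegrE ?addr_ge0 ?powR_ge0 ?invr_ge0 ?(ltW p0)// lerDr
  powR_ge0.
Qed.

Lemma measurable_line_norm (b : R) : measurable_fun setT (line_norm b).
Proof.
apply: (measurableT_comp (measurable_powR p^-1)); apply: measurable_funD => //.
by apply: (measurableT_comp (measurable_powR p)); exact: normr_measurable.
Qed.

Lemma measurable_psi : measurable_fun setT psi.
Proof. exact: continuous_measurable_fun. Qed.

Lemma measurable_correction d (T : measurableType d) (r x : T -> R) :
  measurable_fun setT r -> measurable_fun setT x ->
  measurable_fun setT (fun t => correction (r t) (x t)).
Proof.
move=> mr mx; apply: measurable_funM => //; apply: measurable_funM.
  apply: measurable_funM; first exact: (measurableT_comp measurable_psi mr).
  exact: (measurableT_comp (measurable_powR _) mr).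
apply: (measurableT_comp (measurable_powR (- a))).
exact: (measurableT_comp (@normr_measurable _ setT) mx).
Qed.

Lemma measurable_drift d (T : measurableType d) (r x : T -> R) :
  measurable_fun setT r -> measurable_fun setT x ->
  measurable_fun setT (fun t => drift p a k c (psi (r t)) (r t) (x t)).
Proof.
move=> mr mx.
have mpr : measurable_fun setT (psi \o r) by exact: (measurableT_comp
  measurable_psi mr).
have mrp e : measurable_fun setT (fun t => r t `^ e).
  exact: (measurableT_comp (measurable_powR e) mr).
have mxp e : measurable_fun setT (fun t => x t `^ e).
  exact: (measurableT_comp (measurable_powR e) mx).
apply: measurable_funM.
  by apply: measurable_funM => //; apply: measurable_funM.
apply: measurable_funB => //; apply: measurable_funM; last first.
  apply: measurable_funM => //.
  rewrite (_ : (fun t => _) = (fun t => r t `^ (- p))) => //.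
  by apply/funext => t; rewrite powRN.
apply: measurable_funD => //; apply: measurable_funM => //.
by apply: measurable_funB => //; apply: measurable_funM.
Qed.

Lemma correction_stein (b m s : R) : 0 < b -> 0 < s ->
  (\int[normal_prob m s]_x
    (s ^+ 2 * drift p a k c (psi (line_norm b x)) (line_norm b x) `|x|
     - (x - m) * correction (line_norm b x) x)%:E <= 0)%E.
Proof.
move=> b0 s0; set B := b `^ p^-1.
have B0 : 0 < B by rewrite powR_gt0.
have nc (x : R) : 0 < x -> {for x, continuous (fun y : R => `|y|)}.
  by move=> x0; exact: norm_continuous.
have clx := continuous_line_norm b0.
have lx0 (x : R) : 0 < line_norm b x by exact: line_norm_gt0.
have cpl (x : R) : 0 < x -> (psi (line_norm b y)) @[y --> x] -->
  psi (line_norm b x).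
  by move=> x0; apply: (@cvg_comp _ _ _ (line_norm b) psi (nbhs x) (nbhs
    (line_norm b x))); [exact: clx|exact: psi_cont].
have crl (x e : R) : 0 < x -> (line_norm b y `^ e) @[y --> x] -->
  line_norm b x `^ e.
  by move=> x0; apply: (@cvg_comp _ _ _ (line_norm b) (fun y : R => y `^ e)
    (nbhs x) (nbhs (line_norm b x))); [exact: clx|exact: continuous_powR_gt0].
have cxl (x e : R) : 0 < x -> (`|y| `^ e) @[y --> x] --> `|x| `^ e.
  move=> x0; apply: (@cvg_comp _ _ _ (fun y : R => `|y|) (fun y : R => y `^ e)
    (nbhs x) (nbhs `|x|)); first exact: nc.
  by apply: continuous_powR_gt0; rewrite gtr0_norm.
have le_line (x : R) : `|x| <= line_norm b x by apply: norm_le_line_norm;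
  exact: ltW.
have root_line (x : R) : B <= line_norm b x by apply: root_le_line_norm;
  exact: ltW.
apply: (@normal_stein_le R s (fun x => correction (line_norm b x) x)
  (fun x => drift p a k c (psi (line_norm b x)) (line_norm b x) `|x|) (c / B)).
- exact: s0.
- by apply: measurable_correction; [exact: measurable_line_norm|exact:
  measurable_id].
- move=> x x0; apply: cvgM; last exact: cvg_id.
  by apply: cvgM; [apply: cvgM; [exact: cpl|exact: crl]|exact: cxl].
- move=> x x0; apply: cvgM.
    by apply: cvgM; [apply: cvgM; [exact: cpl|exact: crl]|exact: cxl].
  apply: cvgB; first exact: cvg_cst.
  apply: cvgM.
    apply: cvgD; first exact: cvg_cst.
    apply: cvgM; first exact: cvg_cst.
    by apply: cvgB; [exact: cvg_cst|apply: cvgM; [exact: cpl|exact: cvg_cst]].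
  apply: cvgM; first exact: cxl.
  by apply: cvgV; [rewrite gt_eqF// powR_gt0|exact: crl].
- by move=> x x0; exact: correction_slope.
- move=> x; apply: (le_trans (correction_bound (lx0 x) (le_line x))).
  by rewrite ler_wpM2l ?(ltW c0)// lef_pV2 ?posrE.
- have H : c * B `^ (a - 2) * x `^ (1 - a) @[x --> 0^'+] --> 0.
    rewrite -[X in _ --> X](mulr0 (c * B `^ (a - 2))); apply: cvgM;
      first exact: cvg_cst.
    by apply: powR_cvg0; rewrite subr_gt0.
  apply: (squeeze_cvgr _ (cvg_cst 0) H); near=> x.
  have x0 : 0 < x by near: x; exact: nbhs_right_gt.
  have /andP[ps0 psc] := psi_bound (ltW (lx0 x)).
  apply/andP; split; first by rewrite /correction !mulr_ge0 ?powR_ge0// ltW.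
  rewrite /correction gtr0_norm// (addrC 1) (powRD_gt0 (- a) 1 x0) powRr1 ?(ltW
    x0)//.
  rewrite [leRHS]mulrA; apply: ler_wpM2r; first exact: ltW.
  apply: ler_wpM2r; first exact: powR_ge0.
  apply: ler_pM; [exact: ps0|exact: powR_ge0|exact: psc|].
  by apply: powR_nonpos_le; [exact: B0|exact: root_line|have := a1; lra].
- by move=> x; rewrite /correction /line_norm normrN mulrN.
- by move=> x; rewrite /line_norm normrN.
- move=> m'.
  have i1 := @integrable_normal_powRN R m' s a (lt0r_neq0 s0) a0 a1.
  have i2 := integrableZl measurableT (c * (3 - 2 * a + k) * B `^ (a - 2)) i1.
  apply: (le_integrable measurableT _ _ i2).
    apply/measurable_EFinP; apply: measurable_drift;
      first exact: measurable_line_norm.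
    exact: normr_measurable.
  move=> x _; rewrite /= lee_fin; apply: (le_trans (drift_bound (lx0 x)
    (normr_ge0 x) (le_line x))).
  have C0 : 0 <= c * (3 - 2 * a + k) by rewrite mulr_ge0 ?(ltW c0)//; have :=
    k0; have := a1; lra.
  rewrite [leRHS]ger0_norm; last by apply: mulr_ge0; [apply: mulr_ge0;
    [exact: C0|exact: powR_ge0]|exact: powR_ge0].
  rewrite -[leRHS]mulrA; apply: ler_wpM2l; first exact: C0.
  apply: ler_wpM2r; first exact: powR_ge0.
  by apply: powR_nonpos_le; [exact: B0|exact: root_line|have := a1; lra].
Unshelve. all: by end_near.
Qed.

End coordinate_line.

(** * Integrals over Gaussian vectors *)

Lemma integral_ae_le0 d (T : measurableType d) (R : realType)
    (mu : {measure set T -> \bar R}) (f : T -> \bar R) :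
  measurable_fun setT f -> {ae mu, forall x, (f x <= 0)%E} ->
  (\int[mu]_x f x <= 0)%E.
Proof.
move=> mf f0; rewrite integralE.
rewrite (_ : (\int[mu]_x f^\+ x = 0)%E).
  by rewrite add0e oppe_le0; apply: integral_ge0 => x _; exact: funeneg_ge0.
rewrite -[RHS](@integral0 _ _ _ mu setT); apply: ae_eq_integral.
- exact: measurableT.
- exact: measurable_funepos.
- exact: measurable_cst.
- apply: filterS f0 => x fx _ /=.
  by rewrite funeposE; apply/max_idPr.
Qed.

Lemma ae_le_integrable d (T : measurableType d) (R : realType)
    (mu : {measure set T -> \bar R}) (f g : T -> R) :
  measurable_fun setT f -> mu.-integrable setT (EFin \o g) ->
  {ae mu, forall x, `|f x| <= g x} -> mu.-integrable setT (EFin \o f).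
Proof.
move=> mf intg fg; have mfE : measurable_fun setT (EFin \o f) by
  exact/measurable_EFinP.
have mg := measurable_int _ intg.
apply/integrableP; split => //; move/integrableP : intg => [_];
  apply: le_lt_trans.
apply: ae_ge0_le_integral.
- exact: measurableT.
- by move=> x _; exact: abse_ge0.
- exact: (measurableT_comp _ mfE).
- by move=> x _; exact: abse_ge0.
- exact: (measurableT_comp _ mg).
- apply: filterS fg => x fx _ /=.
  by rewrite lee_fin (le_trans fx)// ler_norm.
Qed.

Section vector_integrals.
Context {R : realType}.
Variables (n : nat) (s : R) (theta : vec R n).
Hypothesis s0 : 0 < s.
Notation Q := (normal_vec s theta).

Lemma integral_resample_le0 (i : 'I_n) (f : vec R n -> \bar R) :
  Q.-integrable setT f ->
  {ae Q, forall z, (\int[normal_prob (tnth theta i) s]_x f (upd z i x) <= 0)%E}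
    ->
  (\int[Q]_z f z <= 0)%E.
Proof.
move=> intf f0; rewrite (integral_resample i intf);
  apply: integral_ae_le0 => //.
exact: (measurable_int _ (integrable_resample i intf)).
Qed.

Lemma normal_prob0 m : normal_prob m s [set 0] = 0%E.
Proof.
have /null_content_dominatesP := normal_prob_dominates m s.
by apply; [exact: measurable_set1|exact: lebesgue_measure_set1].
Qed.

Lemma ae_nonzero : {ae Q, forall z : vec R n, forall i, tnth z i != 0}.
Proof.
apply: filter_forall => i.
exists [set z : vec R n | tnth z i = 0]; split.
- rewrite -[X in measurable X]setTI.
  exact: (@measurable_tnth _ (measurableTypeR R) n i measurableT [set 0]
    (measurable_set1 _)).
- pose A (j : 'I_n) : set (measurableTypeR R) :=
  if j == i then [set 0] else setT.
  have mA j : measurable (A j) by rewrite /A; case: ifP => _ //;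
    exact: measurable_set1.
  rewrite (_ : [set z : vec R n | tnth z i = 0] = box A); last first.
    apply/seteqP; split => z /=.
      by move=> zi j; rewrite /A; case: eqP => [->|].
    by move=> /(_ i); rewrite /A eqxx.
  transitivity (\prod_(j < n) normal_prob (tnth theta j) s (A j))%E.
    exact: normal_vec_box.
  by rewrite (bigD1 i)//= {1}/A eqxx normal_prob0 mul0e.
- by move=> z /= /negP; rewrite negbK => /eqP.
Qed.

(** Independence of a coordinate from a function of the other ones, seen by
   resampling that coordinate. *)
Lemma ge0_integral_coordinateM (i : 'I_n) (u : R -> \bar R) (V : vec R n ->
  \bar R) :
  measurable_fun setT u -> (forall x, 0 <= u x)%E ->
  measurable_fun setT V -> (forall z, 0 <= V z)%E ->
  (forall z x, V (upd z i x) = V z) ->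
  (\int[Q]_z (u (tnth z i) * V z) =
   \int[normal_prob (tnth theta i) s]_x u x * \int[Q]_z V z)%E.
Proof.
move=> mu u0 mV V0 VE.
have mui : measurable_fun setT (fun z : vec R n => u (tnth z i)).
  exact: (measurableT_comp mu (measurable_tnth i)).
rewrite (ge0_integral_resample s theta i (emeasurable_funM mui mV)); last first.
  by move=> z; exact: mule_ge0.
transitivity (\int[Q]_z ((\int[normal_prob (tnth theta i) s]_x u x) * V z))%E.
  apply: eq_integral => z _; rewrite -ge0_integralZr//.
  by apply: eq_integral => x _; rewrite VE tnth_mktuple eqxx.
by rewrite ge0_integralZl//; apply: integral_ge0.
Qed.

(** By independence the integral factors. Three exponents below 1 can add up to
   2, the order of the singularity of the correction at the origin. *)
Lemma integrable_powRN_coordinates (i j l : 'I_n) (e f g : R) :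
  i != j -> i != l -> j != l ->
  0 <= e < 1 -> 0 <= f < 1 -> 0 <= g < 1 ->
  Q.-integrable setT (fun z => (`|tnth z i| `^ (- e) *
    (`|tnth z j| `^ (- f) * `|tnth z l| `^ (- g)))%:E).
Proof.
move=> ij il jl /andP[e0 e1] /andP[f0 f1] /andP[g0 g1].
pose u (e : R) (x : R) : \bar R := (`|x| `^ (- e))%:E.
have u0 e' x : (0 <= u e' x)%E by rewrite lee_fin powR_ge0.
have mu e' : measurable_fun setT (u e').
  apply/measurable_EFinP; apply: (measurableT_comp (measurable_powR (- e'))).
  exact: normr_measurable.
have mui e' (i' : 'I_n) : measurable_fun setT (fun z : vec R n => u e' (tnth z
  i')).
  exact: (measurableT_comp (mu e') (measurable_tnth i')).
have fin m e' : 0 <= e' -> e' < 1 -> (\int[normal_prob m s]_x u e' x < +oo)%E.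
  move=> e0' e1'; have /integrableP[_] := @integrable_normal_powRN R m s e'
    (lt0r_neq0 s0) e0' e1'.
  by congr (_ < _)%E; apply: eq_integral => x _; rewrite gee0_abs ?u0.
have fin0 m e' : (0 <= \int[normal_prob m s]_x u e' x)%E.
  by apply: integral_ge0 => x _; exact: u0.
have mE : measurable_fun setT (fun z : vec R n => (u e (tnth z i) * (u f (tnth
  z j) * u g (tnth z l)))%E).
  by apply: emeasurable_funM => //; apply: emeasurable_funM.
rewrite (_ : (fun z => _) = (fun z : vec R n => (u e (tnth z i) * (u f (tnth z
  j) * u g (tnth z l)))%E)); last first.
  by apply/funext => z; rewrite /u !EFinM.
apply/integrableP; split; first exact: mE.
under eq_integral do rewrite gee0_abs ?mule_ge0 ?u0//.
have updn (i' j' : 'I_n) (z : vec R n) x : i' != j' ->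
  tnth (upd z i' x) j' = tnth z j'.
  by move=> ij'; rewrite tnth_mktuple eq_sym (negbTE ij').
rewrite (ge0_integral_coordinateM (mu e) (u0 e) (emeasurable_funM (mui f j)
  (mui g l))); last 2 first.
- by move=> z; exact: mule_ge0.
- by move=> z x; rewrite !updn.
rewrite (ge0_integral_coordinateM (mu f) (u0 f) (mui g l)); last 2 first.
- by move=> z; exact: u0.
- by move=> z x; rewrite updn.
rewrite (_ : \int[Q]_z u g (tnth z l) = \int[normal_prob (tnth theta l) s]_x u
  g x)%E; last first.
  rewrite -[RHS]mule1 -[X in (_ * X)%E](_ : \int[Q]_z cst 1 z = 1)%E;
    last first.
    by rewrite integral_cst; [rewrite mul1e; exact: probability_setT|exact:
      measurableT].
  rewrite -(ge0_integral_coordinateM (mu g) (u0 g) (@measurable_cst _ _ _ _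
    setT 1%E))//.
  by apply: eq_integral => z _; rewrite mule1.
apply: lte_mul_pinfty => //; first by rewrite ge0_fin_numE ?fin.
by apply: lte_mul_pinfty => //; [rewrite ge0_fin_numE ?fin|exact: fin].
Qed.

End vector_integrals.

(** * The risk of the shrinkage estimator *)

Section risk_bound.
Context {R : realType}.
Variables (d : nat) (s p a k c : R) (psi : R -> R) (theta : vec R d).
Hypothesis d3 : (3 <= d)%N.
Hypothesis s0 : 0 < s.
Hypothesis p0 : 0 < p.
Hypothesis a0 : 0 <= a.
Hypothesis a1 : a < 1.
Hypothesis kE : k = d%:R - 2 - a * (d%:R - 1).
Hypothesis k0 : 0 < k.
Hypothesis cE : c = 2 * k * Num.min 1 (d%:R `^ ((2 - p - a) / p)).
Hypothesis psi_bound : forall v : R, 0 <= v -> 0 <= psi v <= c.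
Hypothesis psi_cont : continuous psi.
Hypothesis psi_cross : forall v w : R, 0 < v -> v <= w ->
  psi v * (c - psi w) * v `^ k <= psi w * (c - psi v) * w `^ k.
Notation Q := (normal_vec s theta).

Let d0 : (0 < d)%N. Proof. exact: leq_trans d3. Qed.
Let c0 : 0 < c.
Proof. by rewrite cE !mulr_gt0// lt_min ltr01 powR_gt0// ltr0n. Qed.

Let r (z : vec R d) := norm_p p z.
Let g i (z : vec R d) := correction a psi (r z) (tnth z i).
Let h i (z : vec R d) := drift p a k c (psi (r z)) (r z) `|tnth z i|.
Let x i (z : vec R d) := tnth z i - tnth theta i.

Let mr : measurable_fun setT r.
Proof.
apply: (measurableT_comp (measurable_powR p^-1)); apply: measurable_sum => i.
apply: (measurableT_comp (measurable_powR p)).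
exact: (measurableT_comp (@normr_measurable _ setT) (measurable_tnth i)).
Qed.

Let mg i : measurable_fun setT (g i).
Proof. by apply: measurable_correction => //; exact: measurable_tnth. Qed.

Let mh i : measurable_fun setT (h i).
Proof.
apply: measurable_drift => //.
exact: (measurableT_comp (@normr_measurable _ setT) (measurable_tnth i)).
Qed.

Let mx i : measurable_fun setT (x i).
Proof. by apply: measurable_funB => //; exact: measurable_tnth. Qed.

Let rest i (z : vec R d) := \sum_(j < d | j != i) `|tnth z j| `^ p.

Let r_upd i z t : r (upd z i t) = line_norm p (rest i z) t.
Proof.
rewrite /r /norm_p /line_norm (bigD1 i (erefl true)) tnth_mktuple eqxx.
congr ((_ + _) `^ _); apply: eq_bigr => j /negbTE ji.
by rewrite tnth_mktuple ji.
Qed.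

Let le_r i z : `|tnth z i| <= r z.
Proof.
rewrite (_ : r z = line_norm p (rest i z) (tnth z i)); last first.
  by rewrite /r /norm_p /line_norm (bigD1 i (erefl true)).
by apply: norm_le_line_norm => //; apply: sumr_ge0 => j _; exact: powR_ge0.
Qed.

Let i0 : 'I_d := Ordinal d0.

Let r_gt0 z : (forall i, tnth z i != 0) -> 0 < r z.
Proof. by move=> z0; apply: (lt_le_trans _ (le_r i0 z)); rewrite normr_gt0. Qed.

Let two_others (i : 'I_d) : exists j l : 'I_d, [/\ i != j, i != l & j != l].
Proof.
move: i; case: d d3 => [//|[//|[//|d']]] _ i.
exists (lift i ord0), (lift i ord_max); split;
  [exact: neq_lift|exact: neq_lift|].
by rewrite (inj_eq lift_inj).
Qed.

(** The order 2 of the singularity is spread over three coordinates as e + f + f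
   with all exponents below 1. As r is at least each coordinate in absolute
   value and e >= b, the factors of r can be traded for coordinates. *)
Let int_sing i (b : R) : 0 <= b -> b < 1 ->
  exists2 G : vec R d -> R, Q.-integrable setT (EFin \o G) &
    forall z, (forall j, tnth z j != 0) -> r z `^ (b - 2) * `|tnth z i| `^ (-
      b) <= G z.
Proof.
move=> b0 b1; have [j [l [ij il jl]]] := two_others i.
pose e := (1 + b) / 2; pose f := (3 - b) / 4.
have e01 : 0 <= e < 1 by rewrite /e; apply/andP; split; lra.
have f01 : 0 <= f < 1 by rewrite /f; apply/andP; split; lra.
exists (fun z => `|tnth z i| `^ (- e) * (`|tnth z j| `^ (- f) * `|tnth z l| `^
  (- f))).
  exact: (integrable_powRN_coordinates theta s0 ij il jl e01 f01 f01).
move=> z z0; have r0 := r_gt0 z0.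
have zp i' : 0 < `|tnth z i'| by rewrite normr_gt0.
have np i' e' : 0 <= e' -> r z `^ (- e') <= `|tnth z i'| `^ (- e').
  by move=> e0'; apply: powR_nonpos_le; rewrite ?oppr_le0.
rewrite (_ : b - 2 = - (e - b) + (- f + - f)); last by rewrite /e /f; field.
rewrite !powRD_gt0// mulrAC (_ : - e = - (e - b) + - b); last by ring.
rewrite (powRD_gt0 _ _ (zp i)) !mulrA.
have eb : 0 <= e - b by rewrite /e; lra.
have [f0 _] := andP f01.
apply: ler_pM; rewrite ?mulr_ge0 ?powR_ge0 ?np//.
apply: ler_pM; rewrite ?mulr_ge0 ?powR_ge0 ?np//.
by rewrite ler_wpM2r ?powR_ge0 ?np.
Qed.

Let int_h i : Q.-integrable setT (EFin \o h i).
Proof.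
have [G intG rG] := int_sing i a0 a1.
have C0 : 0 <= c * (3 - 2 * a + k) by rewrite mulr_ge0 ?(ltW c0)//; have := k0;
  have := a1; lra.
apply: (@ae_le_integrable _ _ _ _ _ (fun z => c * (3 - 2 * a + k) * G z)) => //.
  by have := integrableZl measurableT (c * (3 - 2 * a + k)) intG.
have aen := ae_nonzero s theta; apply: filterS aen => z z0.
have := drift_bound p0 a1 k0 c0 psi_bound (r_gt0 z0) (normr_ge0 _) (le_r i z).
move=> /le_trans; apply; rewrite ler_wpM2l//; exact: rG.
Qed.

Let int_g2 i : Q.-integrable setT (EFin \o (fun z => g i z ^+ 2)).
Proof.
have [G intG rG] := int_sing i (lexx 0) ltr01.
apply: (@ae_le_integrable _ _ _ _ _ (fun z => c ^+ 2 * G z)) => //.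
- exact: measurable_funX.
- by have := integrableZl measurableT (c ^+ 2) intG.
have aen := ae_nonzero s theta; apply: filterS aen => z z0.
rewrite normrX; have r0 := r_gt0 z0.
have := correction_bound a1 c0 psi_bound r0 (le_r i z).
rewrite -/(g i z) => gb.
apply: (@le_trans _ _ ((c / r z) ^+ 2)).
  by rewrite ler_sqr ?nnegrE ?divr_ge0// ltW.
rewrite exprMn ler_wpM2l ?sqr_ge0//.
have := rG z z0; rewrite oppr0 powRr0 mulr1 sub0r; apply: le_trans.
by rewrite powRN powR_mulrn ?exprVn// ltW.
Qed.

Let mean_x2 i : (\int[Q]_z (x i z ^+ 2)%:E = (s ^+ 2)%:E)%E.
Proof.
pose u (t : R) : \bar R := ((t - tnth theta i) ^+ 2)%:E.
have mu : measurable_fun setT u.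
  by apply/measurable_EFinP/measurable_funX; exact: measurable_funB.
have u0 t : (0 <= u t)%E by rewrite lee_fin sqr_ge0.
have := @ge0_integral_coordinateM R d s theta i u (cst 1%E) mu u0
  (@measurable_cst _ _ _ _ setT 1%E).
rewrite integral_cst ?mul1e; last exact: measurableT.
rewrite [X in (_ * X)%E](_ : _ = 1%E); last exact: probability_setT.
rewrite mule1 /u normal_variance// => <- //.
by apply: eq_integral => z _; rewrite mule1.
Qed.

Let int_x2 i : Q.-integrable setT (EFin \o (fun z => x i z ^+ 2)).
Proof.
apply/integrableP; split; first by apply/measurable_EFinP;
  exact: measurable_funX.
under eq_integral do rewrite gee0_abs ?lee_fin ?sqr_ge0//.
by rewrite mean_x2 ltry.
Qed.

Let int_xg i : Q.-integrable setT (EFin \o (fun z => x i z * g i z)).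
Proof.
have int2 := integrableD measurableT (int_x2 i) (int_g2 i).
apply: (@ae_le_integrable _ _ _ _ _ (fun z => x i z ^+ 2 + g i z ^+ 2)).
- exact: measurable_funM.
- exact: int2.
apply: aeW => z /=.
have H1 := sqr_ge0 (x i z - g i z); have H2 := sqr_ge0 (x i z + g i z).
rewrite ler_norml; apply/andP; split; nra.
Qed.

Let int_f i : Q.-integrable setT (EFin \o (fun z => s ^+ 2 * h i z - x i z * g
  i z)).
Proof.
exact: (integrableB measurableT (integrableZl measurableT (s ^+ 2) (int_h i))
  (int_xg i)).
Qed.

(** Resampling the i-th coordinate moves z along a line, on which the
   one-dimensional inequality holds as soon as another coordinate is nonzero. *)
Let stein i : (\int[Q]_z (s ^+ 2 * h i z - x i z * g i z)%:E <= 0)%E.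
Proof.
apply: (integral_resample_le0 (int_f i)).
have aen := ae_nonzero s theta; apply: filterS aen => z z0.
have rest0 : 0 < rest i z.
  have [j [l [ij _ _]]] := two_others i.
  rewrite /rest (bigD1 j)/=; last by rewrite eq_sym.
  rewrite ltr_wpDr ?powR_gt0 ?normr_gt0//.
  by apply: sumr_ge0 => j' _; exact: powR_ge0.
have E t : s ^+ 2 * h i (upd z i t) - x i (upd z i t) * g i (upd z i t) =
    s ^+ 2 * drift p a k c (psi (line_norm p (rest i z) t)) (line_norm p (rest
      i z) t) `|t|
    - (t - tnth theta i) * correction a psi (line_norm p (rest i z) t) t.
  have ut : tnth (upd z i t) i = t by rewrite tnth_mktuple eqxx.
  by rewrite /h /g /x r_upd ut.
under eq_integral => t _ do rewrite [(_ \o _) _](congr1 EFin (E t)).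
exact: correction_stein.
Qed.

(** The part of the loss that is nonpositive pointwise rather than on average. *)
Let gap z := s ^+ 2 * (\sum_i g i z ^+ 2 - 2 * \sum_i h i z).

Let gap_le0 z : (forall i, tnth z i != 0) -> gap z <= 0.
Proof.
move=> z0; rewrite /gap pmulr_rle0 ?exprn_gt0// subr_le0.
have a01 : 0 <= a < 1 by rewrite a0.
have zp i : 0 < `|tnth z i| by rewrite normr_gt0.
have kd : 0 < d%:R - 2 - a * (d%:R - 1) by rewrite -kE.
have := @drift_ge R d (fun i => `|tnth z i|) p a (psi (r z)) d0 zp p0 a01 kd.
rewrite -kE -cE => /(_ (psi_bound (ltW (r_gt0 z0)))); apply: le_trans.
rewrite le_eqVlt; apply/orP; left; apply/eqP; apply: eq_bigr => i _.
rewrite /g /correction (addrC 1) (powRD_gt0 (- a) 1 (zp i)) powRr1;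
  last exact: ltW.
by rewrite mulrA exprMn [in RHS]exprMn real_normK ?num_real.
Qed.

Lemma risk_le : (\int[Q]_z
  (loss s [tuple tnth z i - s ^+ 2 * correction a psi (norm_p p z) (tnth z i) |
    i < d] theta)%:E
  <= d%:R%:E)%E.
Proof.
have s2 : s ^+ 2 != 0 by rewrite expf_neq0// gt_eqF.
pose T z := \sum_i (s ^- 2 * x i z ^+ 2 + 2 * (s ^+ 2 * h i z - x i z * g i z)).
have lossE z : loss s [tuple tnth z i - s ^+ 2 * correction a psi (norm_p p z)
  (tnth z i) | i < d] theta =
    T z + gap z.
  rewrite /loss /T /gap mulr_sumr -sumrB mulr_sumr -big_split/=.
  apply: eq_bigr => i _; rewrite tnth_mktuple -/(r z) -/(g i z) /x.
  by field; rewrite gt_eqF.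
under eq_integral do rewrite lossE EFinD.
have int_T1 i : Q.-integrable setT (fun z => (s ^- 2 * x i z ^+ 2)%:E).
  exact: (integrableZl measurableT (s ^- 2) (int_x2 i)).
have int_T2 i : Q.-integrable setT (fun z => (2 * (s ^+ 2 * h i z - x i z * g i
  z))%:E).
  exact: (integrableZl measurableT 2 (int_f i)).
have int_T : Q.-integrable setT (EFin \o T).
  rewrite (_ : EFin \o T = fun z => \sum_i ((s ^- 2 * x i z ^+ 2)%:E + (2 * (s
    ^+ 2 * h i z - x i z * g i z))%:E))%E; last first.
    by apply/funext => z; rewrite /= /T -sumEFin.
  by apply: integrable_sum; [exact: measurableT|move=> i _; exact: integrableD].
have int_gap : Q.-integrable setT (EFin \o gap).
  have ig : Q.-integrable setT (fun z => \sum_i (g i z ^+ 2)%:E)%E.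
    by apply: integrable_sum; [exact: measurableT|move=> i _; exact: int_g2].
  have ih : Q.-integrable setT (fun z => \sum_i (h i z)%:E)%E.
    by apply: integrable_sum; [exact: measurableT|move=> i _; exact: int_h].
  rewrite (_ : EFin \o gap = fun z => ((s ^+ 2)%:E *
      (\sum_i (g i z ^+ 2)%:E - 2%:E * \sum_i (h i z)%:E))%E).
    exact: (integrableZl measurableT (s ^+ 2) (integrableB measurableT ig
      (integrableZl measurableT 2 ih))).
  apply/funext => z; rewrite !sumEFin.
  by [].
rewrite integralD; [|exact: measurableT|exact: int_T|exact: int_gap].
rewrite -[leRHS]adde0; apply: leeD; last first.
  apply: integral_ae_le0; first exact: (measurable_int _ int_gap).
  have aen := ae_nonzero s theta; apply: filterS aen => z z0.
  by rewrite lee_fin; exact: gap_le0.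
rewrite (_ : (\int[Q]_z (T z)%:E)%E = (\sum_i \int[Q]_z ((s ^- 2 * x i z ^+
  2)%:E + (2 * (s ^+ 2 * h i z - x i z * g i z))%:E))%E); last first.
  rewrite -integral_sum; [|exact: measurableT|by move=> i; exact: integrableD].
  by apply: eq_integral => z _; rewrite /T -sumEFin.
apply: (@le_trans _ _ (\sum_(i < d) 1)%E); last first.
  by rewrite sumEFin sumr_const card_ord.
apply: lee_sum => i _.
rewrite integralD; [|exact: measurableT|exact: int_T1|exact: int_T2].
rewrite -[leRHS]adde0; apply: leeD.
  under eq_integral do rewrite EFinM.
  rewrite integralZl; [|exact: measurableT|exact: int_x2].
  by rewrite mean_x2 -EFinM mulVf.
under eq_integral do rewrite EFinM.
rewrite integralZl; [|exact: measurableT|exact: int_f].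
by rewrite mule_ge0_le0// stein.
Qed.

End risk_bound.

(** * Minimaxity *)

Section profile.
Context {R : realType}.

(** The absolute value extends phi from the half line, so that the profile is
   continuous, hence measurable, on the whole line. *)
Lemma abs_continuous_nonneg_continuous (phi : R -> R) (s : R) : 0 < s ->
  abs_continuous_nonneg phi -> continuous (fun v : R => phi (`|v| / s)).
Proof.
move=> s0 acphi x; apply/cvgrPdist_lt => e e0.
pose X := `|x| / s; have X0 : 0 <= X by rewrite divr_ge0// ltW.
have X1 : 0 <= X + 1 by rewrite addr_ge0.
have [r r0 Hr] := acphi 0 (X + 1) (lexx 0) X1 e e0.
have close u v : 0 <= u -> u <= v -> v <= X + 1 -> v - u < r ->
  `|phi v - phi u| < e.
  move=> u0 uv vX vur; have := Hr 1%N (fun=> u) (fun=> v).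
  by rewrite !big_ord1; apply => // i j; rewrite !ord1 eqxx.
have sr0 : 0 < s * Num.min r 1 by rewrite mulr_gt0// lt_min r0 ltr01.
near=> y.
have xy : `|x - y| < s * Num.min r 1.
  by near: y; exact: (@cvgr_dist_lt _ _ _ (nbhs x) _ (fun y : R => y) x cvg_id
    _ sr0).
pose Y := `|y| / s; have Y0 : 0 <= Y by rewrite divr_ge0// ltW.
have XY : `|X - Y| < Num.min r 1.
  rewrite /X /Y -mulrBl normrM (ger0_norm (_ : 0 <= s^-1)) ?invr_ge0 ?(ltW
    s0)//.
  rewrite ltr_pdivrMr// mulrC; apply: le_lt_trans xy; exact: ler_dist_dist.
move: XY; rewrite lt_min => /andP[XYr XY1].
have [le_XY|/ltW le_YX] := leP X Y.
  rewrite distrC; apply: (close X Y) => //.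
    by move: XY1; rewrite ltr_norml => /andP[? ?]; lra.
  by move: XYr; rewrite ltr_norml => /andP[? ?]; lra.
apply: (close Y X) => //; first by rewrite lerDl.
by move: XYr; rewrite ltr_norml => /andP[? ?]; lra.
Unshelve. all: by end_near. Qed.

(** The monotonicity of gphi, cross-multiplied. In this form it also covers the
   values at which phi reaches c and the quotient loses its meaning. *)
Lemma profile_cross (d : nat) (p a : R) (phi : R -> R)
    (c := 2 * (d%:R - 2) * gamma d p a) (k := d%:R - 2 - a * (d%:R - 1)) :
  (forall v : R, 0 <= v -> 0 <= phi v /\ phi v <= c) ->
  (forall v w : R, 0 <= v -> v <= w -> phi v < c -> phi w < c ->
     gphi d p a phi v <= gphi d p a phi w) ->
  (forall vstar : R, 0 < vstar -> phi vstar = c ->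
     forall v : R, vstar <= v -> phi v = c) ->
  forall v w : R, 0 < v -> v <= w ->
    phi v * (c - phi w) * v `^ k <= phi w * (c - phi v) * w `^ k.
Proof.
move=> bound mono cap v w v0 vw; have w0 : 0 < w by apply: lt_le_trans vw.
have [pv0 pvc] := bound v (ltW v0); have [pw0 pwc] := bound w (ltW w0).
have [pv|pv] := eqVneq (phi v) c.
  by rewrite (cap v v0 pv w vw) pv subrr !mulr0 !mul0r.
have [pw|pw] := eqVneq (phi w) c.
  have cge0 : 0 <= c by rewrite -pw.
  rewrite pw subrr mulr0 mul0r; apply: mulr_ge0; last exact: powR_ge0.
  by apply: mulr_ge0; [exact: cge0|rewrite subr_ge0].
have lv : phi v < c by rewrite lt_neqAle pv.
have lw : phi w < c by rewrite lt_neqAle pw.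
have := mono v w (ltW v0) vw lv lw; rewrite /gphi -/c -/k.
rewrite ler_pdivrMr ?subr_gt0// mulrAC ler_pdivlMr ?subr_gt0//.
congr (_ <= _); ring.
Qed.

Lemma theta_hatE d (s p a : R) (phi : R -> R) (z : vec R d) :
  theta_hat s p a phi z = [tuple tnth z i - s ^+ 2 *
    correction a (fun v : R => phi (`|v| / s)) (norm_p p z) (tnth z i) | i < d].
Proof.
apply: eq_from_tnth => i; rewrite !tnth_mktuple /correction.
rewrite (@ger0_norm _ (norm_p p z)) ?powR_ge0// mulrBl mul1r; congr (_ - _).
rewrite (_ : a - 2 = - (2 - a)); last by ring.
by rewrite !powRN invfM; ring.
Qed.

Lemma riskE n (s : R) disp (Omega : measurableType disp)
    (P : vec R n -> probability Omega R) (Z : {mfun Omega >-> vec R n})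
    (delta : vec R n -> vec R n) (theta : vec R n) :
  (forall A : set (vec R n), measurable A ->
     distribution (P theta) Z A = normal_vec s theta A) ->
  measurable_fun setT delta ->
  (risk s P Z delta theta =
   \int[normal_vec s theta]_z (loss s (delta z) theta)%:E)%E.
Proof.
move=> PZ mdelta; rewrite /risk unlock.
rewrite -(eq_measure_integral _ (fun A mA _ => PZ A mA)).
rewrite ge0_integral_distribution//.
- apply/measurable_EFinP.
  exact: (measurableT_comp (measurable_loss_pair s mdelta) (pair1_measurable
    theta)).
- by move=> z; rewrite lee_fin loss_ge0.
Qed.

End profile.

Theorem theorem2p2 (R : realType) (d : nat) (sigma p alpha : R)
    (phi : R -> R)
    (disp : measure_display) (Omega : measurableType disp)
    (P : vec R d -> probability Omega R) (Z : {mfun Omega >-> vec R d})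
    (c := 2 * (d%:R - 2) * gamma d p alpha) :
  0 < sigma -> 0 < p -> (3 <= d)%N ->
  0 <= alpha -> alpha < (d%:R - 2) / (d%:R - 1) ->
  (forall (theta : vec R d) (A : set (vec R d)), measurable A ->
     distribution (P theta) Z A = normal_vec sigma theta A) ->
  abs_continuous_nonneg phi ->
  (forall v : R, 0 <= v -> 0 <= phi v /\ phi v <= c) ->
  (forall v w : R, 0 <= v -> v <= w -> phi v < c -> phi w < c ->
     gphi d p alpha phi v <= gphi d p alpha phi w) ->
  (forall vstar : R, 0 < vstar -> phi vstar = c ->
     forall v : R, vstar <= v -> phi v = c) ->
  minimax sigma P Z (theta_hat sigma p alpha phi).
Proof.
move=> s0 p0 d3 a0 ad PZ acphi bound mono cap.
have dR : 3 <= d%:R :> R by rewrite ler_nat.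
pose k := d%:R - 2 - alpha * (d%:R - 1).
have k0 : 0 < k.
  by rewrite subr_gt0 -ltr_pdivlMr//; lra.
have a1 : alpha < 1 by apply: (lt_trans ad); rewrite ltr_pdivrMr; lra.
have cE : c = 2 * k * Num.min 1 (d%:R `^ ((2 - p - alpha) / p)).
  rewrite /c /gamma /k; field.
  by rewrite subr_eq0 gt_eqF//; lra.
pose psi (v : R) := phi (`|v| / sigma).
have psi_cont : continuous psi by exact: abs_continuous_nonneg_continuous.
have psi_bound (v : R) : 0 <= v -> 0 <= psi v <= c.
  move=> v0; have [|-> ->//] := bound (`|v| / sigma).
  by rewrite divr_ge0// ltW.
have psi_cross (v w : R) : 0 < v -> v <= w ->
    psi v * (c - psi w) * v `^ k <= psi w * (c - psi v) * w `^ k.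
  move=> v0 vw; have w0 : 0 < w by apply: lt_le_trans vw.
  have vs0 : 0 < v / sigma by rewrite divr_gt0.
  have vws : v / sigma <= w / sigma by rewrite ler_pM2r// invr_gt0.
  have := profile_cross bound mono cap vs0 vws.
  rewrite /psi !gtr0_norm// -/c -/k.
  rewrite !powRM ?invr_ge0 ?(ltW v0) ?(ltW w0) ?(ltW s0)// !mulrA.
  by rewrite ler_pM2r// powR_gt0// invr_gt0.
pose delta (z : vec R d) : vec R d := [tuple tnth z i - sigma ^+ 2 *
    correction alpha psi (norm_p p z) (tnth z i) | i < d].
have hatE : theta_hat sigma p alpha phi = delta.
  by apply/funext => z; exact: theta_hatE.
rewrite hatE.
have mnorm : measurable_fun setT (fun z : vec R d => norm_p p z).
  apply: (measurableT_comp (measurable_powR p^-1)); apply: measurable_sum => i.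
  apply: (measurableT_comp (measurable_powR p)).
  exact: (measurableT_comp (@normr_measurable _ setT) (measurable_tnth i)).
have mdelta : measurable_fun setT delta.
  apply/measurable_fun_tnthP => i.
  rewrite (_ : _ \o _ = fun z : vec R d => tnth z i - sigma ^+ 2 *
      correction alpha psi (norm_p p z) (tnth z i)); last first.
    by apply/funext => z /=; rewrite tnth_mktuple.
  apply: measurable_funB; first exact: measurable_tnth.
  apply: measurable_funM => //; apply: measurable_correction => //.
  exact: measurable_tnth.
split=> // delta' mdelta'.
apply: (@le_trans _ _ d%:R%:E).
  apply: ge_ereal_sup => _ [theta _ <-].
  rewrite (riskE (PZ theta) mdelta).
  exact: (risk_le theta d3 s0 p0 a0 a1 erefl k0 cE psi_bound psi_cont
    psi_cross).
rewrite (_ : risk sigma P Z delta' = fun theta =>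
  (\int[normal_vec sigma theta]_z (loss sigma (delta' z) theta)%:E)%E).
  exact: sup_risk_ge.
by apply/funext => theta; exact: (riskE (PZ theta) mdelta').
Qed.
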